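(* Consider a regression model with parameter vector $\theta$ ($p\times 1$) and a single regression variable $x$, for which designs can be written as $\xi=\{(c_i,\omega_i),\ i=1,\dots,N\}$ with $c_i\in[A,B]$, and suppose that the information matrix for $\theta$ under a design $\xi$ can be written as $$I_\xi(\theta)=P(\theta)\Big(\sum_{i=1}^N\omega_i C(\theta,c_i)\Big)P(\theta)^T,\qquad C(\theta,c)=\big(\Psi_{ij}(c)\big)_{1\le i,j\le p},\quad c\in[A,B],$$ where $P(\theta)$ is a nonsingular $p\times p$ matrix depending only on $\theta$ and $C(\theta,c)$ is a symmetric $p\times p$ matrix. Let $1\le p_1<p$ and let $C_{22}(c)$ be the lower-right $p_1\times p_1$ principal submatrix of $C(\theta,c)$. Let $\Psi_1,\dots,\Psi_{k-1}$ be a maximum set of linearly independent nonconstant functions among the entries $\Psi_{ij}$ in the first $p-p_1$ columns of $C(\theta,c)$. Define, for $1\le t\le k$ and $t\le l\le k$, $$f_{l,t}(c)=\begin{cases}\Psi_l'(c), & t=1,\ l=1,\dots,k-1,\\ C_{22}'(c), & t=1,\ l=k,\\ \left(\dfrac{f_{l,t-1}(c)}{f_{t-1,t-1}(c)}\right)', & 2\le t\le k,\ t\le l\le k,\end{cases}$$ where derivatives of matrices are element-wise. Assume that (i) all functions $\Psi_{ij}$ in $C(\theta,c)$ are at least $k$th order differentiable on $(A,B)$; and (ii) for $1\le l\le k-1$, the functions $f_{l,l}(c)$ have no roots in $[A,B]$. Define $F(c)=\prod_{l=1}^k f_{l,l}(c)$, $c\in[A,B]$. Suppose that either $F(c)$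 or $-F(c)$ is positive definite for all $c\in[A,B]$ (written $F(c)>0$ and $-F(c)>0$, respectively). Then the following complete class results hold: (a) For $k=2n-1$, if $F(c)>0$, the designs with at most $n$ support points, including $B$, form a complete class. (b) For $k=2n-1$, if $-F(c)>0$, the designs with at most $n$ support points, including $A$, form a complete class. (c) For $k=2n$, if $F(c)>0$, the designs with at most $n+1$ support points, including both $A$ and $B$, form a complete class. (d) For $k=2n$, if $-F(c)>0$, the designs with at most $n$ support points form a complete class.
   Context: Design (approximate design): a finite collection $\xi=\{(c_i,\omega_i),\ i=1,\dots,N\}$ of points $c_i\in[A,B]$ (the support points) with weights $\omega_i>0$, $\sum_{i=1}^N\omega_i=1$. The $c_i$ are obtained from the values $x_i$ of the regression variable by a bijection that may depend on $\theta$. The functions $\Psi_{ij}$ may also depend on $\theta$; the value of $\theta$ is fixed (local optimality). Loewner ordering: for symmetric matrices, $M_1\ge M_2$ means $M_1-M_2$ is positive semidefinite. Complete class: a set $\mathcal{D}$ of designs such that for every design $\xi$ there is a design $\xi^*\in\mathcal{D}$ with $I_{\xi^*}(\theta)\ge I_\xi(\theta)$ in the Loewner ordering. The functions $f_{l,t}$ with $l<k$ are scalar; $f_{k,t}$ is $p_1\times p_1$ matrix valued, so $F(c)$ is a $p_1\times p_1$ symmetric matrix.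
   Formalization: In (a)-(c) the endpoints to be included count among the allowed points but may have zero weight; with positive weight required the claim fails, e.g. C=(1,c)^T(1,c) on [0,1], k=2, design {(0,1)}. One-sided derivatives defining f_{l,t} are assumed to exist at A and B. *)

(* Defs.v *)
From HB Require Import structures.
From mathcomp Require Import all_boot all_order all_algebra.
From mathcomp Require Import all_classical all_reals all_analysis.
Import Order.TTheory GRing.Theory Num.Theory.
Import numFieldNormedType.Exports.

Set Implicit Arguments.
Unset Strict Implicit.
Unset Printing Implicit Defensive.

Local Open Scope classical_set_scope.
Local Open Scope ring_scope.

Definition possemidef (R : realType) n (M : 'M[R]_n) : Prop :=
  M^T = M /\ forall v : 'rV[R]_n, 0 <= (v *m M *m v^T) ord0 ord0.

Definition posdef (R : realType) n (M : 'M[R]_n) : Prop :=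
  M^T = M /\ forall v : 'rV[R]_n, v != 0 -> 0 < (v *m M *m v^T) ord0 ord0.

Definition loewner_ge (R : realType) n (M1 M2 : 'M[R]_n) : Prop :=
  possemidef (M1 - M2).

Record design (R : realType) (A B : R) := Design {
  npts : nat;
  pt : 'I_npts -> R;
  wt : 'I_npts -> R;
  pt_inj : injective pt;
  pt_in : forall i, pt i \in `[A, B];
  wt_gt0 : forall i, 0 < wt i;
  wt_sum1 : \sum_(i < npts) wt i = 1 }.

Arguments npts {R A B}.
Arguments pt {R A B}.
Arguments wt {R A B}.

(* The points of [s] count among the [n] allowed points even when the design
   gives them no weight: a design whose support misses some points of [s] is
   admitted provided these can be added without exceeding [n] points. Requiring
   positive weight at the points of [s] would make the complete class results
   fail for designs with few support points: with k = 3, p = 2, p1 = 1,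
   C(c) = c (1, c)^T (1, c) on [1, 2], the one-point design at 3/2 is not
   dominated by any design on at most two points giving weight to 2. *)
Definition at_most_including (R : realType) (A B : R) (n : nat) (s : seq R)
    (xi : design A B) : Prop :=
  (size (undup (s ++ [seq pt xi i | i <- enum 'I_(npts xi)])) <= n)%N.

Definition complete_class (R : realType) (A B : R) p
    (Info : design A B -> 'M[R]_p) (D : design A B -> Prop) : Prop :=
  forall xi, exists xi', D xi' /\ loewner_ge (Info xi') (Info xi).

(* Derivative of a function on [A, B]: the increments are restricted to those
   staying in [A, B], so this is the usual derivative on ]A, B[ and the
   one-sided derivative at A and at B. *)
Definition increments (R : realType) (A B c : R) : set_system R :=
  within [set h | c + h \in `[A, B]] 0^'.

Definition diff_quotient (R : realType) (g : R -> R) (c h : R) : R :=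
  (g (c + h) - g c) / h.

Definition derivable_seg (R : realType) (A B : R) (g : R -> R) (c : R) : Prop :=
  cvg (diff_quotient g c @ increments A B c).

Definition derive_seg (R : realType) (A B : R) (g : R -> R) (c : R) : R :=
  lim (diff_quotient g c @ increments A B c).

Definition differentiable_upto (R : realType) (A B : R) (k : nat) (g : R -> R)
    : Prop :=
  forall j x, (j < k)%N -> x \in `]A, B[ -> derivable (derive1n j g) x 1.

Definition nonconstant_on (R : realType) (A B : R) (g : R -> R) : Prop :=
  ~ exists a, forall c, c \in `[A, B] -> g c = a.

Definition lin_indep_on (R : realType) (A B : R) m (g : 'I_m -> R -> R) : Prop :=
  forall a : 'I_m -> R,
    (forall c, c \in `[A, B] -> \sum_(l < m) a l * g l c = 0) ->
    forall l, a l = 0.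

Definition indep_nonconstant_entries (R : realType) (A B : R) q p1
    (C : R -> 'M[R]_(q + p1)) m (g : 'I_m -> R -> R) : Prop :=
  [/\ forall l, exists i (j : 'I_q),
        forall c, c \in `[A, B] -> g l c = C c i (lshift p1 j),
      forall l, nonconstant_on A B (g l)
    & lin_indep_on A B g].

Definition max_indep_nonconstant_entries (R : realType) (A B : R) q p1
    (C : R -> 'M[R]_(q + p1)) m (g : 'I_m -> R -> R) : Prop :=
  indep_nonconstant_entries A B C g /\
  forall m' (g' : 'I_m' -> R -> R),
    indep_nonconstant_entries A B C g' -> (m' <= m)%N.

(* With g in the role of Psi_l, [frec A B Psi g t] is f_{l,t} (for t >= 1) and
   [fratio A B Psi g t] is f_{l,t} / f_{t,t}, with f_{l,0} / f_{0,0} read as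
   Psi_l: it is the function whose derivative is f_{l,t+1}. *)
Fixpoint fratio (R : realType) (A B : R) (Psi : nat -> R -> R) (g : R -> R)
    (t : nat) : R -> R :=
  if t is s.+1 then
    fun c => derive_seg A B (fratio A B Psi g s) c
             / derive_seg A B (fratio A B Psi (Psi t) s) c
  else g.

Definition frec (R : realType) (A B : R) (Psi : nat -> R -> R) (g : R -> R)
    (t : nat) : R -> R :=
  derive_seg A B (fratio A B Psi g t.-1).

Lemma frec1 (R : realType) (A B : R) Psi (g : R -> R) :
  frec A B Psi g 1 = derive_seg A B g.
Proof. by []. Qed.

Lemma frecS (R : realType) (A B : R) Psi (g : R -> R) t :
  frec A B Psi g t.+2 =
  derive_seg A B
    (fun c => frec A B Psi g t.+1 c / frec A B Psi (Psi t.+1) t.+1 c).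
Proof. by []. Qed.

Definition f_scal (R : realType) (A B : R) (Psi : nat -> R -> R) (l t : nat)
    : R -> R :=
  frec A B Psi (Psi l) t.

Definition C22 (R : realType) q p1 (C : R -> 'M[R]_(q + p1)) (c : R)
    : 'M[R]_p1 :=
  drsubmx (C c).

(* f_{k,t}, the matrix-valued case l = k. *)
Definition f_mat (R : realType) (A B : R) (Psi : nat -> R -> R) q p1
    (C : R -> 'M[R]_(q + p1)) (t : nat) (c : R) : 'M[R]_p1 :=
  \matrix_(i, j) frec A B Psi (fun x => C22 C x i j) t c.

(* All f_{l,t} with 1 <= t <= k, t <= l <= k, are defined at c. *)
Definition f_defined_at (R : realType) (A B : R) (k : nat)
    (Psi : nat -> R -> R) q p1 (C : R -> 'M[R]_(q + p1)) (c : R) : Prop :=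
  (forall t l, (1 <= t)%N -> (t <= l < k)%N ->
     derivable_seg A B (fratio A B Psi (Psi l) t.-1) c) /\
  (forall t i j, (1 <= t <= k)%N ->
     derivable_seg A B (fratio A B Psi (fun x => C22 C x i j) t.-1) c).

Definition Fmat (R : realType) (A B : R) (k : nat) (Psi : nat -> R -> R) q p1
    (C : R -> 'M[R]_(q + p1)) (c : R) : 'M[R]_p1 :=
  (\prod_(1 <= l < k) f_scal A B Psi l l c) *: f_mat A B Psi C k c.

(* Main.v *)
Require Import Defs.
From HB Require Import structures.
From mathcomp Require Import all_boot all_order all_algebra.
From mathcomp Require Import all_classical all_reals all_analysis.
From mathcomp Require Import zify.
Import Order.TTheory GRing.Theory Num.Theory.
Import numFieldNormedType.Exports.
Local Open Scope classical_set_scope.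
Local Open Scope ring_scope.

(* Among the designs dominating a given one there is one of maximal trace, by
   compactness, Caratheodory's theorem bounding the number of support points.
   Let T consist of its support points and of the prescribed endpoints. If T
   were too long, k+1 consecutive points among those of T and the midpoints
   between neighbours would carry a signed measure that annihilates
   1, Psi_1, ..., Psi_(k-1), is negative only at support points and has a
   positive definite integral of C22; adding a small multiple of it would
   increase the trace. The signs of this measure, and of the integrals
   against it, come from k applications of Rolle's theorem interleaved with
   the divisions that define f_(l,t). *)

Set Implicit Arguments.
Unset Strict Implicit.
Unset Printing Implicit Defensive.

(** The weights of the annihilating measure alternate in sign, so only every other node loses mass.
    Midpoints serve as the nodes that gain mass, which may lie anywhere, and points of T as those
    that lose it; hence about k/2 points already suffice for an improvement. The sign of F fixes the
    sign at the last node, hence which parity is negative. This decides whether the outermost nodes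
    are points of T or midpoints, and so which endpoints can belong to T without ever losing mass:
    these are the prescribed ones.

    One measure must serve all quadratic forms at once. Its weights are built from 1 and the Psi_l
    alone; since the recursion is linear in its starting function, v F v^T is the scalar analogue of
    F for v C22 v^T, and the scalar sign argument applies to each v with the same weights.

    The Loewner order is only partial; the trace turns a domination with nonzero difference into a
    strict numerical inequality, which a maximiser rules out. *)

Fixpoint smooth (R : realType) (A B : R) (k : nat) (g : R -> R) : Prop :=
  if k is m.+1 then
    {in `]A, B[, forall x, derivable g x 1} /\ smooth A B m (derive1 g)
  else True.

(** * Calculus of finitely often differentiable functions on the open interval *)

Section Smooth.
Variables (R : realType) (A B : R).
Implicit Types (f g : R -> R) (x : R).

Lemma differentiable_upto_smooth k g :
  differentiable_upto A B k g -> smooth A B k g.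
Proof.
elim: k g => [//|k IH] g Dg; split=> [x xAB|]; first exact: (Dg 0).
by apply: IH => j x jk xAB; rewrite -derive1Sn; exact: Dg.
Qed.

Lemma near_eq_in f g x : {in `]A, B[, f =1 g} -> x \in `]A, B[ ->
  \forall y \near x, f y = g y.
Proof.
move=> fg xAB; have := near_in_itvoo xAB.
by apply: filterS => y; exact: fg.
Qed.

Lemma eq_in_derive1 f g : {in `]A, B[, f =1 g} ->
  {in `]A, B[, (derive1 f) =1 (derive1 g)}.
Proof.
move=> fg x xAB; rewrite !derive1E; apply: near_eq_derive; exact: near_eq_in fg xAB.
Qed.

Lemma eq_in_derivable f g x : {in `]A, B[, f =1 g} -> x \in `]A, B[ ->
  derivable f x 1 -> derivable g x 1.
Proof. by move=> fg xAB; apply: near_eq_derivable; exact: near_eq_in fg xAB. Qed.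

Lemma eq_in_smooth k f g : {in `]A, B[, f =1 g} ->
  smooth A B k f -> smooth A B k g.
Proof.
elim: k f g => [//|k IH] f g fg [Df Sf]; split=> [x xAB|].
  exact: eq_in_derivable fg xAB (Df _ xAB).
exact: IH (eq_in_derive1 fg) Sf.
Qed.

Lemma smoothS k g : smooth A B k.+1 g -> smooth A B k g.
Proof.
elim: k g => [//|k IH] g [Dg Sg]; split=> //; exact: IH.
Qed.

Lemma smooth_cst k a : smooth A B k (cst a).
Proof.
elim: k a => [//|k IH] a; split=> [x _|]; first exact: derivable_cst.
apply: eq_in_smooth (IH 0) => x _; by rewrite derive1_cst.
Qed.

Lemma smoothD k f g : smooth A B k f -> smooth A B k g ->
  smooth A B k (f \+ g).
Proof.
elim: k f g => [//|k IH] f g [Df Sf] [Dg Sg]; split=> [x xAB|].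
  by apply: derivableD; [exact: Df|exact: Dg].
apply: eq_in_smooth (IH _ _ Sf Sg) => x xAB /=.
by rewrite !derive1E deriveD //; [exact: Df|exact: Dg].
Qed.

Lemma smoothM k f g : smooth A B k f -> smooth A B k g ->
  smooth A B k (f \* g).
Proof.
elim: k f g => [//|k IH] f g Sf Sg; have [Df Sf'] := Sf; have [Dg Sg'] := Sg.
split=> [x xAB|].
  by apply: derivableM; [exact: Df|exact: Dg].
apply: eq_in_smooth (smoothD (IH _ _ (smoothS Sf) Sg') (IH _ _ (smoothS Sg) Sf')).
by move=> x xAB /=; rewrite !derive1E deriveM //; [exact: Df|exact: Dg].
Qed.

Lemma smoothV k f : {in `]A, B[, forall x, f x != 0} -> smooth A B k f ->
  smooth A B k (fun x => (f x)^-1).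
Proof.
move=> f0; elim: k => [//|k IH] Sf; have [Df Sf'] := Sf.
split=> [x xAB|].
  by apply: derivableV; [exact: f0 xAB|exact: Df].
have Sv := IH (smoothS Sf).
apply: eq_in_smooth (smoothM (smoothM (@smooth_cst _ (-1)) Sf') (smoothM Sv Sv)).
move=> x xAB /=; rewrite !derive1E deriveV //; [|exact: f0|exact: Df].
by rewrite -exprVn expr2 /= /GRing.scale /= mulN1r mulNr mulrC mulNr.
Qed.

Lemma smooth_continuous k g x : (0 < k)%N -> smooth A B k g -> x \in `]A, B[ ->
  {for x, continuous g}.
Proof.
case: k => // k _ [Dg _] xAB.
by apply/differentiable_continuous; rewrite -derivable1_diffP; exact: Dg.
Qed.

End Smooth.

(** * Derivatives on the closed segment and continuity up to its endpoints *)

Section SegmentDerivative.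
Variables (R : realType) (A B : R).
Implicit Types (g : R -> R) (c : R).

(** At an interior point all small increments stay in the segment, so the restriction is void near
    0. *)
Lemma increments_interior c : c \in `]A, B[ -> increments A B c = 0^'.
Proof.
move=> cAB.
have cn : (+%R c) @ (0 : R) --> c + 0 by apply: cvgD; [exact: cvg_cst|exact: cvg_id].
rewrite addr0 in cn.
have H0 : \forall h \near (0 : R)^', c + h \in `[A, B].
  suff : nbhs (0 : R) (fun h => c + h \in `[A, B]) by exact: (@nbhs_dnbhs R 0).
  apply: (@filterS _ (nbhs (0 : R)) _ (fun h => c + h \in `]A, B[)); last first.
    exact: cn _ (near_in_itvoo cAB).
  move=> h; by rewrite !in_itv /= => /andP[/ltW -> /ltW ->].
apply/seteqP; split=> U; rewrite /increments /within /= => UH.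
  by apply: (@filterS2 _ _ _ _ _ U _ H0 UH) => h ch; exact.
by apply: (@filterS _ (dnbhs (0 : R)) _ U _ _ UH) => h Uh _.
Qed.

Lemma derive_seg_interior g c : c \in `]A, B[ -> derive_seg A B g c = (derive1 g) c.
Proof.
move=> cAB; rewrite /derive_seg increments_interior // /derive1.
suff -> : diff_quotient g c = (fun h => h^-1 *: (g (h + c) - g c)) by [].
by apply/funext => h; rewrite /diff_quotient /GRing.scale /= mulrC (addrC c).
Qed.

Lemma derivable_seg_continuous g c : c \in `[A, B] -> derivable_seg A B g c ->
  (g \o (fun h => c + h)) @ increments A B c --> g c.
Proof.
move=> cAB; rewrite /derivable_seg => /cvg_ex[l gl].
have F : Filter (increments A B c) by exact: within_filter.
have w (U : set R) : dnbhs (0 : R) U -> increments A B c U.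
  by move=> U0; apply: (@filterS _ (dnbhs (0 : R)) _ U _ _ U0).
have idc : (fun h : R => h) @ increments A B c --> (0 : R).
  by move=> U U0; apply: w; exact: (@nbhs_dnbhs R 0 U).
have n0 : increments A B c (fun h => h != 0) by apply: w; rewrite /dnbhs /within; exact: nearW.
have := cvgD (cvg_cst (g c)) (cvgM gl idc).
rewrite mulr0 addr0 => /(_ F F F) H.
apply: cvg_trans H; apply: near_eq_cvg.
apply: (@filterS _ (increments A B c) _ _ _ _ n0) => h h0 /=.
by rewrite /diff_quotient !fctE /= mulfVK ?subrKC.
Qed.

End SegmentDerivative.

Lemma exists_row_kernel (F : fieldType) m n (M : 'M[F]_(m, n)) : (n < m)%N ->
  exists2 v : 'rV_m, v != 0 & v *m M = 0.
Proof.
move=> nm; have : kermx M != 0.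
  by rewrite kermx_eq0 /row_free neq_ltn (leq_ltn_trans (rank_leq_col M)).
by move=> /rowV0Pn[v /sub_kermxP vM v0]; exists v.
Qed.

Lemma derivable_seg_within (R : realType) (A B : R) (g : R -> R) : A < B ->
  {in `]A, B[, continuous g} -> derivable_seg A B g A -> derivable_seg A B g B ->
  {within `[A, B], continuous g}.
Proof.
move=> AB gc gA gB; apply/continuous_within_itvP => //.
have sub (c : R) : (fun y => y - c) @ c --> (0 : R).
  by rewrite -(subrr c); apply: cvgB; [exact: cvg_id|exact: cvg_cst].
split=> // U Ug.
- have /derivable_seg_continuous /(_ gA) H0 : A \in `[A, B].
    by rewrite in_itv /= lexx ltW.
  have H1 : nbhs A (fun y => y - A != 0 -> A + (y - A) \in `[A, B] -> U (g (A + (y - A)))).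
    exact: sub A _ (H0 _ Ug).
  change (nbhs A (fun y => A < y -> U (g y))).
  apply: filterS2 H1 (lt_nbhsl AB) => y; rewrite subrKC => P.
  move=> yB Ay; apply: P.
    by rewrite subr_eq0 gt_eqF.
  by rewrite in_itv /= !ltW.
- have /derivable_seg_continuous /(_ gB) H0 : B \in `[A, B].
    by rewrite in_itv /= lexx ltW.
  have H1 : nbhs B (fun y => y - B != 0 -> B + (y - B) \in `[A, B] -> U (g (B + (y - B)))).
    exact: sub B _ (H0 _ Ug).
  change (nbhs B (fun y => y < B -> U (g y))).
  apply: filterS2 H1 (lt_nbhsr AB) => y; rewrite subrKC => P.
  move=> Ay yB; apply: P.
    by rewrite subr_eq0 lt_eqF.
  by rewrite in_itv /= !ltW.
Qed.

Lemma MVT_derive1 (R : realType) (A B : R) (u : R -> R) a b :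
  {in `]A, B[, forall x, derivable u x 1} ->
  A <= a -> a < b -> b <= B -> {within `[a, b], continuous u} ->
  exists2 c, c \in `]a, b[ & u b - u a = derive1 u c * (b - a).
Proof.
move=> Du Aa ab bB uc; apply: MVT => // x /[!in_itv] /= /andP[ax xb].
rewrite derive1E; apply/derivableP/Du.
by rewrite in_itv /= (le_lt_trans Aa) // (lt_le_trans xb).
Qed.

(** By the mean value theorem a nonvanishing derivative makes [u] injective; a continuous injective
    function on an interval is monotone, which fixes the sign of the derivative. *)
Lemma sgr_derive1_const (R : realType) (A B : R) (u : R -> R) :
  {in `]A, B[, forall x, derivable u x 1} ->
  {in `]A, B[, forall x, derive1 u x != 0} ->
  forall x y, x \in `]A, B[ -> y \in `]A, B[ ->
    Num.sg (derive1 u x) = Num.sg (derive1 u y).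
Proof.
move=> Du u0.
have uc : {within `]A, B[, continuous u} by exact: derivable_within_continuous.
have uclt x y : x \in `]A, B[ -> y \in `]A, B[ -> x < y -> u x != u y.
  move=> /[!in_itv] /= /andP[Ax xB] /andP[Ay yB] xy.
  have [|||c /[!in_itv] /= /andP[xc cy] E] := @MVT_derive1 _ A B u x y Du _ xy.
  - exact: ltW.
  - exact: ltW.
  - apply: continuous_subspaceW uc; apply: subset_itv; rewrite bnd_simp //.
  rewrite -subr_eq0 -oppr_eq0 opprB E mulf_neq0 //; last by rewrite subr_eq0 gt_eqF.
  by apply: u0; rewrite in_itv /= (lt_trans Ax) // (lt_trans cy).
have ui : {in `]A, B[ &, injective u}.
  move=> x y xAB yAB uxy; case: (ltgtP x y) => // xy.
  - by have := uclt _ _ xAB yAB xy; rewrite uxy eqxx.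
  - by have := uclt _ _ yAB xAB xy; rewrite uxy eqxx.
case: (itv_continuous_inj_mono uc ui) => H.
- have P z : z \in `]A, B[ -> Num.sg (derive1 u z) = 1.
    move=> zAB; apply: gtr0_sg; rewrite lt_def u0 //=.
    apply: (@incr_derive1_ge0_itv _ u false true A B) => //.
      by move=> x; rewrite inE; exact: Du.
  by move=> x y xAB yAB; rewrite !P.
- have P z : z \in `]A, B[ -> Num.sg (derive1 u z) = -1.
    move=> zAB; apply: ltr0_sg; rewrite lt_def eq_sym u0 //=.
    apply: (@decr_derive1_le0_itv _ u false true A B) => // x.
    by rewrite inE; exact: Du.
  by move=> x y xAB yAB; rewrite !P.
Qed.

(** * Iterated division and differentiation, and the Chebyshev system 1, Psi_1, ..., Psi_(k-1) *)

Section Ratios.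
Variables (R : realType) (A B : R) (k : nat) (Psi : nat -> R -> R).
Hypothesis Psi_smooth : forall l, (1 <= l < k)%N -> smooth A B k (Psi l).
Hypothesis Psi_noroot : forall l, (1 <= l < k)%N -> {in `]A, B[,
  forall c, derive1 (fratio A B Psi (Psi l) l.-1) c != 0}.
Local Notation L g t := (fratio A B Psi g t).
Implicit Types (g : R -> R) (c : R).

Lemma fratioS g t c : c \in `]A, B[ ->
  L g t.+1 c = derive1 (L g t) c / derive1 (L (Psi t.+1) t) c.
Proof. by move=> cAB /=; rewrite !derive_seg_interior. Qed.

(** Division by a nonvanishing function keeps the order of smoothness; each differentiation costs
    one. *)
Lemma smooth_fratio g t : (t < k)%N -> smooth A B k g ->
  smooth A B (k - t) (L g t).
Proof.
elim: t g => [|t IH] g tk Sg; first by rewrite subn0.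
have E : (k - t = (k - t.+1).+1)%N by rewrite subnS prednK // subn_gt0 ltnW.
have [_ Sg'] : smooth A B (k - t.+1).+1 (L g t) by rewrite -E; apply: IH => //; exact: ltnW.
have [_ Sp'] : smooth A B (k - t.+1).+1 (L (Psi t.+1) t).
  by rewrite -E; apply: IH; [exact: ltnW|exact: Psi_smooth].
apply: eq_in_smooth (smoothM Sg' (smoothV (@Psi_noroot t.+1 _) Sp')) => //.
by move=> c cAB; rewrite fratioS.
Qed.

Lemma derivable_fratio g t : (t < k)%N -> smooth A B k g ->
  {in `]A, B[, forall c, derivable (L g t) c 1}.
Proof.
move=> tk /(smooth_fratio tk); have : (0 < k - t)%N by rewrite subn_gt0.
by case: (k - t)%N => // m _ [].
Qed.

Lemma smooth_sum n (a : 'I_n -> R) (g : 'I_n -> R -> R) :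
  (forall i, smooth A B k (g i)) ->
  smooth A B k (fun x => \sum_(i < n) a i * g i x).
Proof.
elim: n a g => [|n IH] a g Sg.
  by apply: eq_in_smooth (smooth_cst A B k 0) => x _; rewrite big_ord0.
apply: eq_in_smooth (smoothD (IH (a \o widen_ord (leqnSn n)) _ (fun i => Sg (widen_ord (leqnSn n) i)))
  (smoothM (smooth_cst A B k (a ord_max)) (Sg ord_max))) => x _.
by rewrite big_ord_recr.
Qed.

Lemma derive1_lincomb n (a : 'I_n -> R) (h : 'I_n -> R -> R) c :
  (forall i, derivable (h i) c 1) ->
  derive1 (fun x => \sum_(i < n) a i * h i x) c = \sum_(i < n) a i * derive1 (h i) c.
Proof.
move=> Dh; rewrite derive1E.
have -> : (fun x => \sum_(i < n) a i * h i x) = \sum_(i < n) (a i \*o h i).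
  by apply/funext => x; rewrite fct_sumE.
rewrite derive_sum; last by move=> i; exact: derivableZ.
by apply: eq_bigr => i _; rewrite deriveZ // derive1E.
Qed.

Lemma fratio_lincomb n (a : 'I_n -> R) (g : 'I_n -> R -> R) t :
  (t < k)%N -> (forall i, smooth A B k (g i)) ->
  {in `]A, B[, L (fun x => \sum_(i < n) a i * g i x) t
    =1 fun x => \sum_(i < n) a i * L (g i) t x}.
Proof.
move=> + Sg; elim: t => [//|t IH] tk c cAB.
rewrite fratioS // (eq_in_derive1 (IH (ltnW tk))) //.
rewrite derive1_lincomb; last by move=> i; apply: derivable_fratio => //; exact: ltnW.
by rewrite mulr_suml; apply: eq_bigr => i _; rewrite fratioS // mulrA.
Qed.

Lemma fratio_diag l : (1 <= l < k)%N -> {in `]A, B[, L (Psi l) l =1 cst 1}.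
Proof.
case: l => // l lk c cAB; rewrite fratioS // divff //.
by have := @Psi_noroot l.+1 lk _ cAB.
Qed.

Lemma fratio_const g a l t : {in `]A, B[, L g l =1 cst a} -> (l < t)%N ->
  {in `]A, B[, L g t =1 cst 0}.
Proof.
move=> La; elim: t => // t IH; rewrite ltnS leq_eqVlt => /orP[/eqP <-|lt] c cAB.
  by rewrite fratioS // (eq_in_derive1 La) // derive1_cst mul0r.
by rewrite fratioS // (eq_in_derive1 (IH lt)) // derive1_cst mul0r.
Qed.

(* The constant sign of f_{l,l} on ]A, B[, read off at the midpoint. *)
Definition fsign l : R := Num.sg (derive1 (L (Psi l) l.-1) ((A + B) / 2)).

Hypothesis AB : A < B.

Lemma fsignE l c : (1 <= l < k)%N -> c \in `]A, B[ ->
  Num.sg (derive1 (L (Psi l) l.-1) c) = fsign l.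
Proof.
move=> lk cAB; apply: (@sgr_derive1_const _ A B) => //.
- apply: derivable_fratio; last exact: Psi_smooth.
  by case: l lk => // l /andP[_ /ltnW].
- exact: Psi_noroot.
- by rewrite in_itv /= midf_lt ?(midf_lt AB).
Qed.

(* Rolle's theorem, keeping track of the sign at the last point. *)
Lemma sign_descent g r t (y : nat -> R) : smooth A B k g -> (t + r < k)%N ->
  A <= y 0 -> y r.+1 <= B -> (forall i, (i <= r)%N -> y i < y i.+1) ->
  {within `[y 0, y r.+1], continuous (L g t)} ->
  (forall i, (i <= r)%N -> L g t (y i) = 0) ->
  exists2 z, z \in `]A, B[ &
    Num.sg (L g t (y r.+1)) =
    (\prod_(i < r) fsign (t + i.+1)) * Num.sg (derive1 (L g (t + r)) z).
Proof.
move=> Sg; elim: r t y => [|r IH] t y trk Ay yB ylt yc y0.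
  rewrite addn0 in trk *.
  have [z zi E] := @MVT_derive1 _ A B _ _ _ (derivable_fratio trk Sg) Ay (ylt 0%N isT) yB yc.
  exists z.
    by apply: subset_itvW zi => //; exact: ltW.
  rewrite (y0 0%N) // subr0 in E.
  by rewrite E big_ord0 mul1r sgrM [X in _ * X]gtr0_sg ?mulr1 // subr_gt0; exact: ylt.
have ymono i j : (i <= j)%N -> (j <= r.+2)%N -> y i <= y j.
  move=> /subnK <-; elim: (j - i)%N => [//|d IHd] dr.
  by apply: le_trans (IHd (ltnW dr)) _; apply/ltW/ylt.
have tk : (t < k)%N by apply: leq_ltn_trans trk; rewrite leq_addr.
(* Between two zeros the mean value theorem is Rolle's and gives a zero of the derivative; on the
   last interval it gives a point where the derivative has the sign of the last value. Dividing by
   f_(t+1,t+1) then yields the same configuration one level up, with one point fewer. The value 0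
   beyond [r.+1] only makes the choice function total. *)
have step i : exists z, (i <= r.+1)%N -> (y i < z < y i.+1) /\
    (0 < y i.+1 - y i /\ L g t (y i.+1) = derive1 (L g t) z * (y i.+1 - y i)).
  case: (leqP i r.+1) => ir; last by exists 0.
  have yci : {within `[y i, y i.+1], continuous (L g t)}.
    apply: continuous_subspaceW yc.
    by apply: subset_itv; rewrite bnd_simp; apply: ymono => //; exact: ltnW.
  have [||z zi E] := @MVT_derive1 _ A B _ _ _ (derivable_fratio tk Sg) _ (ylt i ir) _ yci.
  - by apply: le_trans Ay _; apply: ymono => //; exact: leqW.
  - by apply: le_trans yB; apply: ymono.
  exists z => _; split; first by move: zi; rewrite in_itv.
  split; first by rewrite subr_gt0 ylt.
  by rewrite -E (y0 i) // subr0.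
have [z zP] := boolp.choice step.
have zAB i : (i <= r.+1)%N -> z i \in `]A, B[.
  move=> ir; have [/andP[zi iz] _] := zP _ ir; rewrite in_itv /=.
  apply/andP; split; [apply: le_lt_trans zi|apply: lt_le_trans iz _].
  - by apply: le_trans Ay _; apply: ymono => //; exact: leqW.
  - by apply: le_trans yB; apply: ymono.
have [|||i ir||i ir|w wAB E] := IH t.+1 z.
- by rewrite addSnnS.
- by have := zAB 0%N isT; rewrite in_itv /= => /andP[/ltW].
- by have := zAB r.+1 (leqnn _); rewrite in_itv /= => /andP[_ /ltW].
- have [/andP[_ z1] _] := zP i (leqW ir); have [/andP[z2 _] _] := zP i.+1 ir.
  exact: lt_trans z2.
- apply: derivable_within_continuous => x xz; apply: derivable_fratio => //.
    by apply: leq_ltn_trans trk; rewrite addnS ltnS leq_addr.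
  move: xz (zAB 0%N isT) (zAB r.+1 (leqnn _)); rewrite !in_itv /=.
  move=> /andP[zx xz] /andP[Az _] /andP[_ zB].
  by rewrite (lt_le_trans Az) // (le_lt_trans xz).
- have [_ [d0 /esym/eqP]] := zP i (leqW ir).
  rewrite y0 // mulf_eq0 (gt_eqF d0) orbF => /eqP E.
  by rewrite fratioS ?E ?mul0r //; apply: zAB; exact: leqW.
exists w => //; rewrite big_ord_recl addn1.
under eq_bigr => i _ do rewrite lift0 -addSnnS.
rewrite addnS -addSn -mulrA -E.
have zr := zAB r.+1 (leqnn _).
have [_ [d0 ->]] := zP r.+1 (leqnn _).
have tk1 : (1 <= t.+1 < k)%N by apply: leq_ltn_trans trk; rewrite addnS ltnS leq_addr.
rewrite fratioS // !sgrM sgrV (@fsignE t.+1) // (gtr0_sg d0) mulr1 mulrCA.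
have := @Psi_noroot t.+1 tk1 _ zr; rewrite -sgr_eq0 (@fsignE t.+1) // => f0.
by rewrite -expr2 /fsign sqr_sg -sgr_eq0 f0 mulr1.
Qed.


(** The constant is included so that annihilating weights have total mass 0 and can be added to a
    design. *)
Definition phi l : R -> R := if l is 0%N then cst 1 else Psi l.

Lemma phi_smooth l : (l < k)%N -> smooth A B k (phi l).
Proof. case: l => [|l] lk; [exact: smooth_cst|exact: Psi_smooth]. Qed.

Lemma derive1_fratio_phi l m z : (l <= m < k)%N -> z \in `]A, B[ ->
  derive1 (L (phi l) m) z = 0.
Proof.
move=> /andP[lm mk] zAB.
have diag : {in `]A, B[, L (phi l) l =1 cst 1}.
  case: l lm => [//|l] lm; apply: fratio_diag => //; exact: leq_ltn_trans mk.
move: lm; rewrite leq_eqVlt => /orP[/eqP <-|lm].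
  by rewrite (eq_in_derive1 diag) // derive1_cst.
by rewrite (eq_in_derive1 (fratio_const diag lm)) // derive1_cst.
Qed.

(** After l steps [phi l] has become the constant 1, and the next derivative kills it. So m steps
    and a derivative annihilate phi_0, ..., phi_m and isolate the top coefficient. *)
Lemma derive1_fratio_lincomb m (a : nat -> R) (psi : nat -> R -> R) z :
  (m < k)%N -> z \in `]A, B[ -> (forall l, (l <= m)%N -> psi l = phi l) ->
  smooth A B k (psi m.+1) ->
  derive1 (L (fun x => \sum_(l < m.+2) a l * psi l x) m) z =
  a m.+1 * derive1 (L (psi m.+1) m) z.
Proof.
move=> mk zAB psiE Sm.
have Sp (i : 'I_m.+2) : smooth A B k (psi i).
  have := ltn_ord i; rewrite ltnS leq_eqVlt => /orP[/eqP -> //|]; rewrite ltnS => im.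
  by rewrite psiE //; apply: phi_smooth; exact: leq_ltn_trans mk.
rewrite (eq_in_derive1 (@fratio_lincomb _ _ (fun i => psi (nat_of_ord i)) _ mk Sp)) //.
rewrite derive1_lincomb; last by move=> i; exact: derivable_fratio.
rewrite big_ord_recr /= big1 ?add0r // => i _.
have im : (i <= m)%N by rewrite -ltnS.
by rewrite psiE // derive1_fratio_phi ?mulr0 // im.
Qed.

Lemma prod_fsign_neq0 m : (m < k)%N -> \prod_(i < m) fsign (0 + i.+1) != 0.
Proof.
move=> mk; apply/prodf_neq0 => i _; rewrite add0n /fsign sgr_eq0.
apply: Psi_noroot; last by rewrite in_itv /= !midf_lt.
exact: leq_ltn_trans mk.
Qed.

Hypothesis Psi_cont : forall l, (1 <= l < k)%N -> {within `[A, B], continuous (Psi l)}.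

Lemma phi_cont l : (l < k)%N -> {within `[A, B], continuous (phi l)}.
Proof.
case: l => [|l] lk; last exact: Psi_cont.
by apply: continuous_subspaceT => x; exact: cvg_cst.
Qed.

Lemma within_lincomb n (D : set R) (a : nat -> R) (psi : nat -> R -> R) :
  (forall l, (l < n)%N -> {within D, continuous (psi l)}) ->
  {within D, continuous (fun x => \sum_(l < n) a l * psi l x)}.
Proof.
elim: n => [|n IH] pc.
  under eq_fun do rewrite big_ord0.
  by apply: continuous_subspaceT => x; exact: cvg_cst.
under eq_fun do rewrite big_ord_recr /=.
move=> x; apply: cvgD; first by apply: IH => l ln; apply: pc; exact: ltnW.
by apply: cvgM; [exact: cvg_cst|exact: pc].
Qed.

(** This is the Chebyshev property: a nonzero combination of m+1 of the [phi] has at most m zeros.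
    With m.+2 zeros among m.+2 functions, the descent ends at a point where the top coefficient
    times f_(m+1,m+1) is 0; so that coefficient vanishes and the rest follows by induction. *)
Lemma phi_zeros m (a x : nat -> R) : (m < k)%N ->
  A <= x 0 -> x m <= B -> (forall i, (i < m)%N -> x i < x i.+1) ->
  (forall i, (i <= m)%N -> \sum_(l < m.+1) a l * phi l (x i) = 0) ->
  forall l, (l <= m)%N -> a l = 0.
Proof.
elim: m => [|m IH] mk Ax xB xlt fx.
  move=> l; rewrite leqn0 => /eqP ->.
  by have := fx 0%N isT; rewrite big_ord1 mulr1.
have mk' : (m < k)%N by exact: ltnW.
suff am : a m.+1 = 0.
  move=> l; rewrite leq_eqVlt => /orP[/eqP -> //|]; apply: IH => //.
  - by apply: le_trans xB; apply/ltW/xlt.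
  - by move=> i im; apply: xlt; exact: ltnW.
  - by move=> i im; have := fx i (leqW im); rewrite big_ord_recr /= am mul0r addr0.
have Sf : smooth A B k (fun y => \sum_(l < m.+2) a l * phi l y).
  apply: (@smooth_sum _ (fun l => a (nat_of_ord l)) (fun l => phi (nat_of_ord l))) => i.
  by apply: phi_smooth; exact: leq_trans mk.
have xmono i j : (i <= j)%N -> (j <= m.+1)%N -> x i <= x j.
  move=> /subnK <-; elim: (j - i)%N => [//|d IHd] dr.
  by apply: le_trans (IHd (ltnW dr)) _; apply/ltW/xlt.
have [||z zAB] := @sign_descent _ m 0 x Sf mk' Ax xB xlt.
- apply: (@continuous_subspaceW _ _ _ `[A, B]).
    by apply: subset_itv; rewrite bnd_simp.
  by apply: within_lincomb => l lm; apply: phi_cont; exact: leq_trans mk.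
- by move=> i im; exact/fx/leqW.
rewrite /= fx // sgr0 => /esym/eqP.
rewrite mulf_eq0 (negbTE (prod_fsign_neq0 mk')) /= sgr_eq0.
rewrite derive1_fratio_lincomb //; last exact: phi_smooth.
rewrite mulf_eq0 => /orP[/eqP //|].
by rewrite (negbTE (@Psi_noroot m.+1 _ _ zAB)).
Qed.

Lemma IVT0 (f : R -> R) a b : a <= b -> {within `[a, b], continuous f} ->
  f a * f b <= 0 -> exists2 z, a <= z <= b & f z = 0.
Proof.
move=> ab fc fab.
have [|z] := @IVT _ f a b 0 ab fc; last by rewrite in_itv /=; exists z.
rewrite ge_min le_max; apply/andP.
case: (ltrP 0 (f a)) fab => [fa|fa].
  by rewrite pmulr_rle0 // => fb; rewrite ?fb ?(ltW fa) ?orbT.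
case: (ltrP (f b) 0) => [fb|fb] fab; last by rewrite ?fa ?fb ?orbT.
have a0 : f a = 0.
  by apply/le_anti; rewrite fa /=; move: fab; rewrite nmulr_lle0.
by rewrite ?a0 ?lexx.
Qed.

(** There is one unknown more than there are equations. It serves both for combinations of functions
    with prescribed zeros and for weights with prescribed moments. *)
Lemma exists_annihilator m (h : nat -> nat -> R) :
  exists a : nat -> R, (exists2 i, (i <= m)%N & a i != 0) /\
    forall j, (j < m)%N -> \sum_(i < m.+1) a i * h i j = 0.
Proof.
pose M := \matrix_(i < m.+1, j < m) h i j.
have [v v0 vM] := exists_row_kernel M (ltnSn m).
exists (fun i => v ord0 (inord i)); split.
  have /rV0Pn[i vi] := v0; exists i; first by rewrite -ltnS.
  by rewrite inord_val.
move=> j jm; have /matrixP/(_ ord0 (Ordinal jm)) := vM.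
rewrite !mxE => vj; rewrite -[RHS]vj; apply: eq_bigr => i _.
by rewrite inord_val mxE.
Qed.

(** * Alternating weights at k+1 nodes *)

Section Annihilator.
Variable x : nat -> R.
Hypothesis k_gt0 : (0 < k)%N.
Hypothesis Ax : A <= x 0.
Hypothesis xB : x k <= B.
Hypothesis xlt : forall i, (i < k)%N -> x i < x i.+1.

Lemma nodes_le i j : (i <= j)%N -> (j <= k)%N -> x i <= x j.
Proof.
move=> /subnK <-; elim: (j - i)%N => [//|d IHd] dr.
by apply: le_trans (IHd (ltnW dr)) _; apply/ltW/xlt.
Qed.

Lemma nodes_lt i j : (i < j)%N -> (j <= k)%N -> x i < x j.
Proof.
move=> ij jk; apply: lt_le_trans (nodes_le ij jk); apply: xlt; exact: leq_trans jk.
Qed.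

(* An element of the span of the phi_l vanishing at all nodes except two
   neighbours has the same sign at these, for it has no further zero. *)
Lemma neighbours_function j : (j < k)%N ->
  exists a : nat -> R, let f y := \sum_(l < k) a l * phi l y in
  0 < f (x j) * f (x j.+1) /\
  forall i, (i <= k)%N -> i != j -> i != j.+1 -> f (x i) = 0.
Proof.
move=> jk; case: k k_gt0 jk nodes_lt nodes_le Ax xB phi_zeros phi_cont => // m _ jm nlt nle A0 Bm pz pc.
(* [p] lists the m nodes other than the two neighbours, where k has become [m.+1]. *)
pose p i := if (i < j)%N then x i else x i.+2.
have [a [[i0 i0m ai0] aP]] := exists_annihilator m (fun l i => phi l (p i)).
exists a => f; split; last first.
  move=> i im ij ij1; case: (ltnP i j) => ij2.
    by have := aP i; rewrite /p ij2; apply; exact: leq_trans ij2 jm.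
  have j2i : (j.+2 <= i)%N by rewrite !ltn_neqAle eq_sym ij1 eq_sym ij.
  have := aP i.-2; rewrite /p; case: i im ij ij1 ij2 j2i => [|[|i]] //= im _ _ _ j2i.
  by rewrite (ltnNge i j) (j2i : (j <= i)%N) /=; apply.
rewrite ltNge; apply/negP => fle.
have [||z /andP[zl zr] fz] := @IVT0 f (x j) (x j.+1) _ _ fle.
- by apply: nle.
- apply: (@continuous_subspaceW _ _ _ `[A, B]).
    apply: subset_itv; rewrite bnd_simp.
      by apply: le_trans A0 _; apply: nle => //; exact: ltnW.
    by apply: le_trans Bm; apply: nle.
  by apply: within_lincomb.
suff : a i0 = 0 by move/eqP; rewrite (negbTE ai0).
(* The zero [z] between the neighbours takes the place of both: together with the other nodes this
   makes m+1 zeros, one too many. *)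
pose q i := if (i < j)%N then x i else if i == j then z else x i.+1.
apply: (pz m a q (ltnSn m)) => //.
- rewrite /q; case: ltnP => // j0; case: eqP => [_|_]; last by apply: le_trans A0 _; exact: nle.
  apply: le_trans zl; apply: le_trans A0 _; apply: nle => //; exact: ltnW.
- rewrite /q; case: ltnP => mj; first by apply: le_trans Bm; exact: nle.
  by case: eqP => // mj'; apply: le_trans zr _; apply: le_trans Bm; exact: nle.
- move=> i im; rewrite /q; case: (ltngtP i j) => ij.
  + case: (ltngtP i.+1 j) => ij1.
    * by apply: nlt => //; exact: leqW.
    * by move: ij1; rewrite ltnS leqNgt ij.
    * by apply: lt_le_trans zl; apply: nlt => //; exact: ltnW.
  + by rewrite ltnNge (leqW (ltnW ij)) /= gtn_eqF ?ltnS //; [apply: nlt|exact: ltnW].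
  + rewrite ij ltnNge leqnSn /= gtn_eqF //; apply: le_lt_trans zr _.
    by apply: nlt => //; rewrite -ij.
- move=> i im; rewrite /q; case: (ltngtP i j) => ij //.
  + by have := aP i; rewrite /p ij; apply; exact: leq_trans ij jm.
  + case: i im ij => // i im ij; have := aP i; rewrite /p (ltnNge i j) (ij : (j <= i)%N) /=; exact.
Qed.

(** Pairing annihilating weights with the function that vanishes at all nodes but x_j and x_(j+1)
    leaves two terms of sum 0. As the function has the same sign at both nodes, the two weights have
    opposite signs or are both 0. *)
Lemma exists_alternating : exists sigma : nat -> R,
  [/\ 0 < sigma k,
      forall i, (i < k)%N -> sigma i * sigma i.+1 < 0
    & forall l, (l < k)%N -> \sum_(i < k.+1) sigma i * phi l (x i) = 0].
Proof.
have [s [[i0 i0k si0] sP]] := exists_annihilator k (fun i l => phi l (x i)).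
have comb (a : nat -> R) : \sum_(i < k.+1) s i * (\sum_(l < k) a l * phi l (x i)) = 0.
  under eq_bigr => i _ do rewrite mulr_sumr.
  rewrite exchange_big big1 // => l _.
  under eq_bigr => i _ do rewrite mulrCA.
  by rewrite -mulr_sumr sP ?mulr0.
have step j : (j < k)%N -> exists2 c, 0 < c & s j = - (c * s j.+1).
  move=> jk; have [a fP] := neighbours_function jk.
  pose f y := \sum_(l < k) a l * phi l y.
  have [fpos fz] : 0 < f (x j) * f (x j.+1) /\
    forall i, (i <= k)%N -> i != j -> i != j.+1 -> f (x i) = 0 := fP.
  have : \sum_(i < k.+1) s i * f (x i) = 0 := comb a.
  have j1 : (j < k.+1)%N by exact: leqW.
  have j2 : (j.+1 < k.+1)%N by [].
  rewrite (bigD1 (Ordinal j1)) //= (bigD1 (Ordinal j2)) /=; last first.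
    by rewrite -val_eqE /= gtn_eqF.
  rewrite [X in _ + (_ + X)]big1 ?addr0; last first.
    move=> i /andP[]; rewrite -!val_eqE /= => ij ij1.
    by rewrite fz ?mulr0 // -ltnS.
  move=> /eqP; rewrite addr_eq0 => /eqP E.
  have fj : f (x j) != 0 by apply: contraTneq fpos => ->; rewrite mul0r ltxx.
  exists (f (x j.+1) / f (x j)).
    by rewrite -(pmulr_lgt0 _ (_ : 0 < f (x j) ^+ 2)) ?exprn_even_gt0 // expr2 mulrA divfK // mulrC.
  by apply: (mulIf fj); rewrite E mulNr mulrAC divfK // mulrC.
(* A zero at the last node would spread downwards through [step] and kill the nonzero weight
   [s i0]. *)
have sk : s k != 0.
  apply: contra_neq si0 => sk0.
  suff H d : (d <= k)%N -> s (k - d)%N = 0 by rewrite -(subKn i0k); apply: H; rewrite leq_subr.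
  elim: d => [|d IH] dk; first by rewrite subn0.
  have [|c _ ->] := step (k - d.+1)%N; first by rewrite ltn_subrL.
  by rewrite -subSn // subSS IH ?mulr0 ?oppr0 // ltnW.
have sN0 d : (d <= k)%N -> s (k - d)%N != 0.
  elim: d => [|d IH] dk; first by rewrite subn0.
  have [|c c0 ->] := step (k - d.+1)%N; first by rewrite ltn_subrL.
  rewrite -subSn // subSS oppr_eq0; apply: mulf_neq0; [exact: lt0r_neq0|exact/IH/ltnW].
exists (fun i => s i * s k); split.
- by rewrite -expr2 exprn_even_gt0.
- move=> i ik; have [c c0 ->] := step i ik.
  have s1 : s i.+1 != 0 by rewrite -(subKn ik) sN0 ?leq_subr.
  rewrite mulrACA pmulr_llt0 -?expr2 ?exprn_even_gt0 //.
  by rewrite mulNr oppr_lt0 -mulrA -expr2 mulr_gt0 // exprn_even_gt0.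
- move=> l lk; under eq_bigr => i _ do rewrite mulrAC.
  by rewrite -mulr_suml sP ?mul0r.
Qed.

(* Interpolating g at the first k nodes by the phi_l reduces the sum to its
   last term. *)
Lemma sgr_alternating_sum (sigma : nat -> R) (g : R -> R) :
  smooth A B k g -> {within `[A, B], continuous g} ->
  (forall l, (l < k)%N -> \sum_(i < k.+1) sigma i * phi l (x i) = 0) ->
  exists2 z, z \in `]A, B[ &
    Num.sg (\sum_(i < k.+1) sigma i * g (x i)) =
    Num.sg (sigma k) *
    Num.sg ((\prod_(1 <= l < k) derive1 (L (Psi l) l.-1) z) * derive1 (L g k.-1) z).
Proof.
move=> Sg gc sP.
pose psi l := if (l < k)%N then phi l else g.
have [b [[i0 i0k bi0] bP]] := exists_annihilator k (fun l i => psi l (x i)).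
pose f y := \sum_(l < k.+1) b l * psi l y.
have fE y : f y = \sum_(l < k) b l * phi l y + b k * g y.
  rewrite /f big_ord_recr /= {2}/psi ltnn; congr (_ + _).
  by apply: eq_bigr => l _; rewrite /psi ltn_ord.
have bk : b k != 0.
  apply: contra_neq bi0 => bk0.
  have H : forall i, (i <= k.-1)%N -> b i = 0.
    apply: (@phi_zeros _ _ x) => //.
    - by rewrite prednK.
    - by apply: le_trans xB; apply: nodes_le => //; exact: leq_pred.
    - by move=> i ik; apply: xlt; apply: leq_trans ik _; exact: leq_pred.
    - move=> i; rewrite -ltnS prednK // => ik.
      by have := bP i ik; rewrite -/(f _) fE bk0 mul0r addr0.
  move: i0k; rewrite leq_eqVlt => /orP[/eqP -> //|ik].
  by apply: H; rewrite -ltnS prednK.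
have Sp l : (l <= k)%N -> smooth A B k (psi l).
  move=> lk; rewrite /psi; case: ifP => // lk'; exact: phi_smooth.
have cp l : (l <= k)%N -> {within `[A, B], continuous (psi l)}.
  move=> lk; rewrite /psi; case: ifP => // lk'; exact: phi_cont.
have Sf : smooth A B k f.
  apply: (@smooth_sum _ (fun l => b (nat_of_ord l)) (fun l => psi (nat_of_ord l))) => i.
  by apply: Sp; rewrite -ltnS.
have k1 : (0 + k.-1 < k)%N by rewrite add0n prednK.
have [|i ik||i ik|z zAB] := @sign_descent _ k.-1 0 x Sf k1 Ax.
- by rewrite prednK.
- by apply: xlt; rewrite -(prednK k_gt0).
- apply: (@continuous_subspaceW _ _ _ `[A, B]).
    by apply: subset_itv; rewrite bnd_simp // prednK.
  by apply: within_lincomb => l lm; exact: cp.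
- by apply: bP; rewrite -(prednK k_gt0).
rewrite prednK // add0n /= => E; exists z => //.
(* The weighted sum of [f] is computed twice: its zeros leave the last node only, while the
   annihilated [phi] leave [g] only. *)
have sumE : b k * (\sum_(i < k.+1) sigma i * g (x i)) = sigma k * f (x k).
  have : \sum_(i < k.+1) sigma i * f (x i) = sigma k * f (x k).
    rewrite big_ord_recr /= big1 ?add0r // => i _.
    by rewrite /f bP ?mulr0.
  move=> <-; under [RHS]eq_bigr => i _ do rewrite fE mulrDr.
  rewrite big_split /= [X in _ = X + _](_ : _ = 0); last first.
    under eq_bigr => i _ do rewrite mulr_sumr.
    rewrite exchange_big big1 // => l _.
    under eq_bigr => i _ do rewrite mulrCA.
    by rewrite -mulr_sumr sP ?mulr0.
  by rewrite add0r mulr_sumr; apply: eq_bigr => i _; rewrite mulrCA.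
have dE : derive1 (L f k.-1) z = b k * derive1 (L g k.-1) z.
  have := @derive1_fratio_lincomb k.-1 b psi z k1 zAB.
  rewrite prednK // {2 4}/psi ltnn => -> //.
  by move=> l lk; rewrite /psi; case: ltnP => //; rewrite leqNgt -(prednK k_gt0) ltnS lk.
have bk2 : Num.sg (b k) * Num.sg (b k) = 1.
  by rewrite -sgrM gtr0_sg // -expr2 exprn_even_gt0.
rewrite -[LHS]mul1r -bk2 -mulrA -sgrM sumE sgrM E dE !sgrM mulrCA; congr (_ * _).
rewrite mulrCA (mulrA (Num.sg (b k))) bk2 mul1r; congr (_ * _).
rewrite big_add1 big_mkord.
elim/big_rec2 : _ => [|i u v _ ->]; first by rewrite sgr1.
(* Each f_(l,l) has constant sign, so all factors can be read at the one point [z], as in the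
   definition of F. *)
rewrite sgrM; congr (_ * _); rewrite add0n fsignE //.
by have := ltn_ord i; rewrite -ltnS (prednK k_gt0).
Qed.

End Annihilator.
End Ratios.

(** * Finite mixtures of matrices and the number of points they need *)

Lemma caratheodory_step (R : realType) (T : Type) d n (f : T -> 'rV[R]_d)
    (c : 'I_n.+1 -> T) (w : 'I_n.+1 -> R) :
  (d < n)%N -> (forall i, 0 <= w i) -> \sum_i w i = 1 ->
  exists (i0 : 'I_n.+1) (w' : 'I_n -> R), [/\ forall i, 0 <= w' i, \sum_i w' i = 1 &
    \sum_i w' i *: f (c (lift i0 i)) = \sum_i w i *: f (c i)].
Proof.
move=> dn w0 w1.
(* The column of ones makes the dependency affine, so that moving the weights along it preserves
   their sum. *)
pose M := \matrix_i row_mx (f (c i)) (1 : 'rV[R]_1).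
have [v v0 vM] : exists2 v : 'rV_n.+1, v != 0 & v *m M = 0.
  by apply: exists_row_kernel; rewrite addn1.
have vMs : v *m M = \sum_i v ord0 i *: row_mx (f (c i)) (1 : 'rV[R]_1).
  by rewrite mulmx_sum_row; apply: eq_bigr => i _; rewrite rowK.
have vf : \sum_i v ord0 i *: f (c i) = 0.
  have /(congr1 lsubmx) : \sum_i v ord0 i *: row_mx (f (c i)) (1 : 'rV[R]_1) = 0 by rewrite -vMs.
  rewrite !linear0 linear_sum /= => {2}<-.
  by apply: eq_bigr => i _; rewrite linearZ /= row_mxKl.
have vs : \sum_i v ord0 i = 0.
  have /(congr1 rsubmx) : \sum_i v ord0 i *: row_mx (f (c i)) (1 : 'rV[R]_1) = 0 by rewrite -vMs.
  rewrite !linear0 linear_sum /= => /rowP/(_ ord0); rewrite summxE mxE => E.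
  rewrite -{2}E; apply: eq_bigr => i _; rewrite linearZ /= row_mxKr !mxE.
  by rewrite eqxx mulr1.
have [i1 vi1] : exists i, 0 < v ord0 i.
  have /rV0Pn[i vi] := v0.
  apply/existsP; apply: contraT; rewrite negb_exists => /forallP npos.
  have H : forall j, true -> 0 <= - v ord0 j by move=> j _; rewrite oppr_ge0 leNgt npos.
  have : \sum_j - v ord0 j == 0 by rewrite sumrN vs oppr0.
  rewrite psumr_eq0 // => /allP/(_ i); rewrite mem_index_enum oppr_eq0 (negbTE vi).
  by move=> /(_ isT).
(* When a growing multiple of [v] is subtracted from [w], the first weight to reach 0 is that of
   smallest ratio among those with positive [v]. *)
pose r i := w i / v ord0 i.
have [i0 vi0 imin] :=
  @Order.TotalTheory.arg_minP _ _ _ i1 (fun i => 0 < v ord0 i) r vi1.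
have shift : w i0 - r i0 * v ord0 i0 = 0.
  by rewrite /r divfK ?gt_eqF // subrr.
exists i0, (fun i => w (lift i0 i) - r i0 * v ord0 (lift i0 i)); split.
- move=> i; set j := lift i0 i; rewrite subr_ge0.
  have r0 : 0 <= r i0 by rewrite divr_ge0 // ltW.
  case: (lerP (v ord0 j) 0) => vj; first by apply: le_trans (w0 j); rewrite mulr_ge0_le0.
  by rewrite -ler_pdivlMr //; exact: imin.
- rewrite -[RHS]w1 [RHS](bigD1_ord i0) //= sumrB -mulr_sumr.
  have := vs; rewrite (bigD1_ord i0) //= => /eqP; rewrite addrC addr_eq0 => /eqP ->.
  rewrite mulrN opprK addrC; congr (_ + _); apply/eqP; rewrite eq_sym -subr_eq0.
  by rewrite shift.
- rewrite [RHS](bigD1_ord i0) //=.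
  under eq_bigr => i _ do rewrite scalerBl -scalerA.
  rewrite sumrB -scaler_sumr.
  have := vf; rewrite (bigD1_ord i0) //= => /eqP; rewrite addrC addr_eq0 => /eqP ->.
  rewrite scalerN opprK addrC scalerA; congr (_ + _ *: _); apply/eqP.
  by rewrite eq_sym -subr_eq0 shift.
Qed.

Section Mixtures.
Variables (R : realType) (A B : R) (p : nat) (C : R -> 'M[R]_p).

(** Unlike in a design, points may coincide and weights may vanish: these conditions are closed,
    which the compactness argument needs. *)
Definition mixture n (c w : 'I_n -> R) (M : 'M[R]_p) : Prop :=
  [/\ forall i, c i \in `[A, B], forall i, 0 <= w i, \sum_i w i = 1
    & \sum_i w i *: C (c i) = M].

Definition attainable (M : 'M[R]_p) : Prop :=
  exists n (c w : 'I_n -> R), mixture c w M.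

Lemma caratheodory M : attainable M ->
  exists c w : 'I_(p * p).+1 -> R, mixture c w M.
Proof.
move=> [n]; elim: n => [|n IH] [c [w [cAB w0 w1 wM]]].
  by move: w1; rewrite big_ord0 => /eqP; rewrite eq_sym oner_eq0.
case: (ltnP (p * p) n) => pn.
  have [i0 [w' [w'0 w'1 w'M]]] := caratheodory_step (mxvec \o C) c pn w0 w1.
  apply: IH; exists (c \o lift i0), w'; split=> //=.
  apply: (can_inj mxvecK); rewrite -wM !linear_sum /=.
  under eq_bigr => i _ do rewrite linearZ.
  under [RHS]eq_bigr => i _ do rewrite linearZ.
  exact: w'M.
(* Short mixtures are padded to the fixed length by weights 0 at the point that [inord] returns by
   default. *)
pose u i := inord i : 'I_n.+1.
have E (V : zmodType) (F : 'I_n.+1 -> V) :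
    \sum_(i < (p * p).+1) (if (i < n.+1)%N then F (u i) else 0) = \sum_i F i.
  rewrite -big_mkcond /= -(@big_ord_widen _ _ _ n.+1 (p * p).+1 (F \o u)) //=.
  by apply: eq_bigr => i _; rewrite /u inord_val.
exists (fun i => c (u i)), (fun i => if (i < n.+1)%N then w (u i) else 0); split=> //.
- by move=> i; case: ifP.
- by rewrite E.
- rewrite -wM -(E _ (fun i => w i *: C (c i))); apply: eq_bigr => i _.
  by case: ifP => // _; rewrite scale0r.
Qed.

Lemma attainable_seq (s : seq (R * R)) :
  (forall z, z \in s -> z.1 \in `[A, B] /\ 0 <= z.2) -> \sum_(z <- s) z.2 = 1 ->
  attainable (\sum_(z <- s) z.2 *: C z.1).
Proof.
move=> sP s1; exists (size s), (fun i => (tnth (in_tuple s) i).1),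
  (fun i => (tnth (in_tuple s) i).2); split.
- by move=> i; have [] := sP _ (mem_tnth i (in_tuple s)).
- by move=> i; have [] := sP _ (mem_tnth i (in_tuple s)).
- by rewrite -s1 [RHS]big_tnth.
- by rewrite [RHS]big_tnth.
Qed.

(** Coinciding points are merged and those of weight 0 dropped. The identity [E] is stated for any
    module, so that it gives the total mass as well as the matrix. *)
Lemma attainable_support M : attainable M ->
  exists (S : seq R) (W : R -> R), [/\ uniq S,
    forall x, x \in S -> x \in `[A, B] /\ 0 < W x,
    \sum_(x <- S) W x = 1 & \sum_(x <- S) W x *: C x = M].
Proof.
move=> [n [c [w [cAB w0 w1 wM]]]].
pose W x := \sum_(i | c i == x) w i.
pose U := undup (codom c).
have W0 x : 0 <= W x by apply: sumr_ge0.
have E (V : lmodType R) (F : R -> V) :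
    \sum_(x <- [seq x <- U | W x != 0]) W x *: F x = \sum_i w i *: F (c i).
  rewrite big_filter big_mkcond /=.
  rewrite (eq_bigr (fun x => \sum_i (if c i == x then w i *: F (c i) else 0))); last first.
    move=> x _; rewrite (_ : (if _ then _ else _) = W x *: F x); last first.
      by case: eqP => //= ->; rewrite scale0r.
    rewrite scaler_suml big_mkcond; apply: eq_bigr => i _.
    by case: eqP => // ->.
  rewrite exchange_big; apply: eq_bigr => i _ /=.
  rewrite (bigD1_seq (c i)) ?undup_uniq //=; last by rewrite mem_undup codom_f.
  rewrite eqxx big1 ?addr0 // => x /negbTE xc; rewrite eq_sym xc //.
exists [seq x <- U | W x != 0], W; split.
- by rewrite filter_uniq // undup_uniq.
- move=> x; rewrite mem_filter mem_undup => /andP[Wx xU].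
  split; last by rewrite lt_def Wx W0.
  by move: xU => /codomP[i ->].
- have := E R^o (fun=> 1); rewrite /GRing.scale /=.
  under eq_bigr => i _ do rewrite mulr1.
  by under [RHS]eq_bigr => i _ do rewrite mulr1; rewrite w1.
- by rewrite E.
Qed.

Lemma uniform_lower_bound (S : seq R) (W : R -> R) (b : R) : 0 < b ->
  (forall x, x \in S -> 0 < W x) ->
  exists2 e, 0 < e & forall x, x \in S -> e * b <= W x.
Proof.
move=> b0; elim: S => [|y S IH] W0; first by exists 1.
have [|e e0 eP] := IH; first by move=> x xS; apply: W0; rewrite inE xS orbT.
have Wy : 0 < W y by apply: W0; rewrite mem_head.
exists (Num.min e (W y / b)); first by rewrite lt_min e0 divr_gt0.
move=> x; rewrite inE => /orP[/eqP ->|xS].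
  by rewrite -ler_pdivlMr // ge_min lexx orbT.
by apply: le_trans (eP _ xS); rewrite ler_pM2r // ge_min lexx.
Qed.

(** Mass is removed only at points that carry some, so a small enough step keeps all weights
    nonnegative. *)
Lemma attainable_perturb (S : seq R) (W : R -> R) k (x : nat -> R) (s : nat -> R) :
  uniq S -> (forall y, y \in S -> y \in `[A, B] /\ 0 < W y) -> \sum_(y <- S) W y = 1 ->
  (forall i, (i < k)%N -> x i \in `[A, B]) ->
  (forall i, (i < k)%N -> s i < 0 -> x i \in S) ->
  \sum_(i < k) s i = 0 ->
  exists2 e, 0 < e &
    attainable (\sum_(y <- S) W y *: C y + e *: \sum_(i < k) s i *: C (x i)).
Proof.
move=> uS SP W1 xAB sneg s0.
(* [b] bounds the mass that a unit step can remove at any point; the summand 1 keeps it positive. *)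
pose b := 1 + \sum_(i < k) `|s i|.
have b0 : 0 < b by rewrite ltr_wpDr // sumr_ge0.
have [e e0 eP] : exists2 e, 0 < e & forall y, y \in S -> e * b <= W y.
  by apply: uniform_lower_bound => // y /SP[].
pose N i := Num.max 0 (- s i); pose Q i := Num.max 0 (s i).
have QN i : s i = Q i - N i.
  rewrite /Q /N; case: (lerP 0 (s i)) => si.
    by rewrite (max_l (_ : - s i <= 0)) ?oppr_le0 // subr0.
  by rewrite max_r ?oppr_ge0 ?ltW // sub0r opprK.
have N0 i : 0 <= N i by rewrite le_max lexx.
have Nle i : N i <= `|s i| by rewrite ge_max normr_ge0 -normrN ler_norm.
pose D y := \sum_(i < k | x i == y) N i.
have DE (V : lmodType R) (F : R -> V) :
    \sum_(y <- S) D y *: F y = \sum_(i < k) N i *: F (x i).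
  rewrite (eq_bigr (fun y => \sum_(i < k) (if x i == y then N i *: F (x i) else 0))); last first.
    move=> y _; rewrite scaler_suml big_mkcond; apply: eq_bigr => i _.
    by case: eqP => // ->.
  rewrite exchange_big; apply: eq_bigr => i _ /=.
  have [xS|xS] := boolP (x i \in S).
    rewrite (bigD1_seq (x i)) //= eqxx big1 ?addr0 // => y /negbTE yx.
    by rewrite eq_sym yx.
  have -> : N i = 0.
    apply: max_l; rewrite oppr_le0 leNgt; apply: contra xS; exact: sneg.
  by rewrite scale0r big1 // => y _; rewrite if_same.
exists e => //.
(* Negative parts are taken off the old weights; positive parts are appended as new points, possibly
   repeating old ones. *)
pose T := [seq (y, W y - e * D y) | y <- S] ++ [seq (x i, e * Q i) | i : 'I_k].
have TE (V : lmodType R) (F : R -> V) : \sum_(z <- T) z.2 *: F z.1 =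
    \sum_(y <- S) W y *: F y + e *: \sum_(i < k) s i *: F (x i).
  rewrite big_cat /= big_map big_image /=.
  under eq_bigr => y _ do rewrite scalerBl -scalerA.
  rewrite sumrB -scaler_sumr DE -addrA; congr (_ + _).
  under [X in _ + X]eq_bigr => i _ do rewrite -scalerA.
  rewrite -scaler_sumr addrC -scalerBr -sumrB; congr (_ *: _).
  by apply: eq_bigr => i _; rewrite QN scalerBl.
rewrite -TE; apply: attainable_seq.
- move=> z; rewrite mem_cat => /orP[/mapP[y yS ->]|/codomP[i ->]] /=.
    have [yAB Wy] := SP _ yS; split=> //; rewrite subr_ge0.
    apply: le_trans (eP _ yS); rewrite ler_pM2l // /b.
    apply: le_trans (_ : \sum_(i < k) `|s i| <= _); last by rewrite lerDr.
    rewrite /D big_mkcond; apply: ler_sum => i _; case: ifP => // _.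
  by split; [exact: xAB|apply: mulr_ge0; [exact: ltW|rewrite le_max lexx]].
- have := TE R^o (fun=> 1); rewrite /GRing.scale /=.
  under eq_bigr => i _ do rewrite mulr1.
  under [X in X + _]eq_bigr => i _ do rewrite mulr1.
  under [X in _ + _ * X]eq_bigr => i _ do rewrite mulr1.
  by rewrite W1 s0 mulr0 addr0.
Qed.

Definition quad (M : 'M[R]_p) (v : 'rV[R]_p) : R := (v *m M *m v^T) ord0 ord0.

Lemma quadE M v : quad M v = \sum_i \sum_j v ord0 i * M i j * v ord0 j.
Proof.
rewrite /quad mxE exchange_big; apply: eq_bigr => j _ /=.
by rewrite mxE mulr_suml; apply: eq_bigr => i _; rewrite !mxE.
Qed.

Lemma quadD M N v : quad (M + N) v = quad M v + quad N v.
Proof. by rewrite /quad mulmxDr mulmxDl mxE. Qed.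

Lemma quadZ a M v : quad (a *: M) v = a * quad M v.
Proof. by rewrite /quad -scalemxAr -scalemxAl mxE. Qed.

Lemma quad0 v : quad 0 v = 0.
Proof. by rewrite /quad mulmx0 mul0mx mxE. Qed.

Lemma quad_sum n (a : 'I_n -> R) (M : 'I_n -> 'M[R]_p) v :
  quad (\sum_i a i *: M i) v = \sum_i a i * quad (M i) v.
Proof.
elim: n a M => [|n IH] a M; first by rewrite !big_ord0 quad0.
by rewrite !big_ord_recr /= quadD quadZ IH.
Qed.

End Mixtures.

(** * Existence of a dominating mixture of maximal trace *)

Section MaximalTrace.
Variables (R : realType) (A B : R) (p : nat) (C : R -> 'M[R]_p).
Hypothesis AB : A <= B.
Hypothesis C_cont : forall i j, {within `[A, B], continuous (fun c => C c i j)}.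

Lemma continuous_fun_sum (T : topologicalType) (I : Type) (r : seq I) (F : I -> T -> R) :
  (forall i, continuous (F i)) -> continuous (fun x => \sum_(i <- r) F i x).
Proof.
by move=> Fc x; apply: cvg_big => [|i _]; [exact: add_continuous|exact: Fc].
Qed.

(** Composing with this retraction makes functions continuous on [A, B] continuous on the whole
    line, so that the functionals below are continuous on the full vector space. *)
Let clamp (y : R) : R := Num.max A (Num.min y B).

Lemma clamp_in y : clamp y \in `[A, B].
Proof. by rewrite in_itv /= /clamp le_max lexx ge_max AB ge_min lexx orbT. Qed.

Lemma clamp_id y : y \in `[A, B] -> clamp y = y.
Proof. by rewrite in_itv /= /clamp => /andP[Ay yB]; rewrite min_l // max_r. Qed.

Lemma continuous_clamp (g : R -> R) :
  {within `[A, B], continuous g} -> continuous (g \o clamp).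
Proof.
move=> gc y U Ug.
have clc : {for y, continuous clamp}.
  apply: (@max_fun_continuous _ _ R (fun=> A) (fun y => Num.min y B)).
    by move=> z; exact: cvg_cst.
  apply: (@min_fun_continuous _ _ R id (fun=> B)) => z; first exact: cvg_id.
  exact: cvg_cst.
have H : within `[A, B]%classic (nbhs (clamp y)) (fun z => U (g z)).
  by have /subspace_continuousP/(_ _ (clamp_in y)) gy := gc; exact: gy _ Ug.
apply: (@filterS _ (nbhs y) _ (fun t => `[A, B]%classic (clamp t) -> U (g (clamp t)))).
  by move=> t; apply; exact: clamp_in.
exact: clc _ H.
Qed.

Lemma quad_within v : {within `[A, B], continuous (fun c => quad (C c) v)}.
Proof.
have -> : (fun c => quad (C c) v) =
    (fun c => \sum_i \sum_j v ord0 i * C c i j * v ord0 j).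
  by apply/funext => c; rewrite quadE.
apply: continuous_fun_sum => i; apply: continuous_fun_sum => j x.
apply: cvgM; last exact: cvg_cst.
by apply: cvgM; [exact: cvg_cst|exact: C_cont].
Qed.

Lemma trace_within : {within `[A, B], continuous (fun c => \tr (C c))}.
Proof. by rewrite /mxtrace; apply: continuous_fun_sum => i; exact: C_cont. Qed.

(** A fixed number [K] of points suffices, so a mixture is a vector of K points and K weights in a
    compact box, on which the trace is continuous. *)
Lemma exists_max_trace M0 : attainable A B C M0 ->
  exists M1, [/\ attainable A B C M1, forall v, 0 <= quad (M1 - M0) v
    & forall M, attainable A B C M -> (forall v, 0 <= quad (M - M0) v) ->
        \tr M <= \tr M1].
Proof.
move=> M0att; pose K := (p * p).+1.
pose pos (u : 'rV[R]_(K + K)) (l : 'I_K) := clamp (u ord0 (lshift K l)).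
pose wgt (u : 'rV[R]_(K + K)) (l : 'I_K) := u ord0 (rshift K l).
pose J (h : R -> R) u := \sum_l wgt u l * h (pos u l).
have Icont h : {within `[A, B], continuous h} -> continuous (J h).
  move=> hc; apply: continuous_fun_sum => l u; apply: cvgM.
  - exact: (nbhs_filter u).
  - exact: (@coord_continuous R 1 (K + K) ord0 (rshift K l) u).
  - apply: (@continuous_comp _ _ _ (fun u : 'rV[R]_(K + K) => u ord0 (lshift K l)) (h \o clamp)).
    exact: (@coord_continuous R 1 (K + K) ord0 (lshift K l) u).
  exact: continuous_clamp.
pose Mu u := \sum_l wgt u l *: C (pos u l).
have Iquad u v : quad (Mu u) v = J (fun c => quad (C c) v) u by rewrite quad_sum.
have Itr u : \tr (Mu u) = J (fun c => \tr (C c)) u.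
  by rewrite /Mu linear_sum; apply: eq_bigr => l _; exact: mxtraceZ.
pose box (i : 'I_(K + K)) : set R :=
  if fintype.split i is inl _ then `[A, B]%classic else `[0, 1]%classic.
pose X := [set u : 'rV[R]_(K + K) | forall i, box i (u ord0 i)].
have Xc : compact X.
  by apply: rV_compact => i; rewrite /box; case: fintype.split => _; exact: segment_compact.
(* Domination is closed, being an intersection of closed conditions, one for each [v]. *)
pose Y := [set u | J (fun=> 1) u = 1] `&`
  \bigcap_(v in [set: 'rV[R]_p]) [set u | quad M0 v <= J (fun c => quad (C c) v) u].
have Yc : closed Y.
  apply: closedI.
    apply: (@preimage_closed _ _ (J (fun=> 1)) [set x | x = 1]); last exact: closed_eq.
    move=> u _; apply: Icont; apply: continuous_subspaceT => x; exact: cvg_cst.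
  apply: closed_bigI => v _.
  apply: (@preimage_closed _ _ (J (fun c => quad (C c) v)) [set x | quad M0 v <= x]); last exact: closed_ge.
  move=> u _; apply: Icont; exact: quad_within.
have XYc : compact (X `&` Y) by exact: compact_closedI.
have XYP u : (X `&` Y) u -> mixture A B C (pos u) (wgt u) (Mu u) /\
    forall v, 0 <= quad (Mu u - M0) v.
  move=> [Xu [Yu1 Yu2]]; split.
    split=> //.
    - by move=> l; exact: clamp_in.
    - move=> l; have := Xu (rshift K l).
      by rewrite /box (unsplitK (inr l)) /= in_itv /= => /andP[].
    - by move: Yu1; rewrite /= /J /=; under eq_bigr => l _ do rewrite mulr1.
  move=> v; have := Yu2 v I; rewrite /= -Iquad.
  by rewrite -scaleN1r quadD quadZ mulN1r subr_ge0.
have XYsurj M : attainable A B C M -> (forall v, 0 <= quad (M - M0) v) ->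
    exists2 u, (X `&` Y) u & Mu u = M.
  move=> /caratheodory[c [w [cAB w0 w1 wM]]] Mge.
  pose u : 'rV[R]_(K + K) := row_mx (\row_l c l) (\row_l w l).
  have pu l : pos u l = c l by rewrite /pos row_mxEl mxE clamp_id.
  have wu l : wgt u l = w l by rewrite /wgt row_mxEr mxE.
  have MuE : Mu u = M.
    by rewrite -wM; apply: eq_bigr => l _; rewrite pu wu.
  exists u => //; split; [|split].
  - move=> i; rewrite /box -[in u _ i](splitK i); case: fintype.split => l /=.
      by rewrite row_mxEl mxE; exact: cAB.
    rewrite row_mxEr mxE in_itv /= w0 -w1 (bigD1 l) //= lerDl.
    exact: sumr_ge0.
  - by rewrite /= /J -[RHS]w1 /=; apply: eq_bigr => l _; rewrite wu mulr1.
  - move=> v _ /=; rewrite -Iquad MuE -subr_ge0.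
    by have := Mge v; rewrite -scaleN1r quadD quadZ mulN1r.
have [||u uXY umax] := @compact_EVT_max _ _ (J (fun c => \tr (C c))) (X `&` Y) _ XYc.
- have [|u uXY _] := XYsurj _ M0att; last by exists u.
  by move=> v; rewrite subrr quad0.
- apply: continuous_subspaceT; apply: Icont; exact: trace_within.
have {uXY} [uM uge] := XYP _ (set_mem uXY).
exists (Mu u); split=> //; first by exists K, (pos u), (wgt u).
move=> M Matt /(XYsurj _ Matt)[u' u'XY <-].
by rewrite !Itr; apply: umax; exact: mem_set.
Qed.

End MaximalTrace.

Lemma design_of_support (R : realType) (A B : R) (S : seq R) (W : R -> R) :
  uniq S -> (forall x, x \in S -> x \in `[A, B] /\ 0 < W x) ->
  \sum_(x <- S) W x = 1 ->
  exists xi : design A B, [seq pt xi i | i <- enum 'I_(npts xi)] = S /\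
    forall p (C : R -> 'M[R]_p),
      \sum_(i < npts xi) wt xi i *: C (pt xi i) = \sum_(x <- S) W x *: C x.
Proof.
move=> uS SP W1.
pose x i := tnth (in_tuple S) i.
have xinj : injective x by apply/tuple_uniqP.
have xAB i : x i \in `[A, B] by have [] := SP _ (mem_tnth i (in_tuple S)).
have Wx i : 0 < W (x i) by have [] := SP _ (mem_tnth i (in_tuple S)).
have W1' : \sum_(i < size S) W (x i) = 1 by rewrite -W1 [RHS]big_tnth.
exists (Design xinj xAB Wx W1'); split=> /=; first exact: map_tnth_enum (in_tuple S).
by move=> p C; rewrite [RHS]big_tnth.
Qed.

(** * Points interleaved with midpoints *)

Section Nodes.
Variables (R : realType) (T : seq R).
Hypothesis T_sorted : sorted <%R T.
Local Notation t i := (nth 0 T i).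

(* The points of T alternating with the midpoints between neighbours. *)
Definition node i : R := (t i./2 + t i.+1./2) / 2.

Lemma nth_sorted_lt i j : (i < j)%N -> (j < size T)%N -> t i < t j.
Proof. by move=> ij jT; rewrite lt_sorted_ltn_nth // inE (ltn_trans ij). Qed.

Lemma node_even i : ~~ odd i -> node i = t i./2.
Proof.
by move=> io; rewrite /node -uphalfE uphalf_half (negbTE io) add0n -mulr2n -(mulr_natr (t _)) mulfK.
Qed.

Lemma node_lt i : (i./2.+1 < size T)%N -> node i < node i.+1.
Proof.
move=> iT; rewrite /node ltr_pM2r ?invr_gt0 // addrC ltrD2l.
exact: nth_sorted_lt.
Qed.

Lemma node_in A B i : (forall x, x \in T -> x \in `[A, B]) -> (i.+1./2 < size T)%N ->
  node i \in `[A, B].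
Proof.
move=> TAB iT.
have iT' : (i./2 < size T)%N by apply: leq_ltn_trans iT; exact/half_leq/leqnSn.
have := TAB _ (mem_nth 0 iT); have := TAB _ (mem_nth 0 iT').
rewrite !in_itv /= /node ler_pdivlMr // ler_pdivrMr // => /andP[? ?] /andP[? ?].
by rewrite !mulr_natr !mulr2n !lerD.
Qed.

End Nodes.

Lemma quad_block0 (R : realType) q p (D : 'M[R]_(q + p)) v :
  (forall a j, D a (lshift p j) = 0) -> D^T = D ->
  quad D v = quad (drsubmx D) (rsubmx v).
Proof.
move=> D0 Ds.
have D0' j a : D (lshift p j) a = 0 by rewrite -Ds mxE.
rewrite !quadE big_split_ord /= big1 ?add0r; last first.
  by move=> i _; rewrite big1 // => j _; rewrite D0' mulr0 mul0r.
apply: eq_bigr => i _; rewrite big_split_ord /= big1 ?add0r; last first.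
  by move=> j _; rewrite D0 mulr0 mul0r.
by apply: eq_bigr => j _; rewrite !mxE.
Qed.

Lemma trace_posdef (R : realType) p (D : 'M[R]_p) : (0 < p)%N ->
  (forall v, v != 0 -> 0 < quad D v) -> 0 < \tr D.
Proof.
move=> p0 Dpos.
have E i : D i i = quad D (delta_mx ord0 i).
  rewrite quadE (bigD1 i) //= (bigD1 i) //= !mxE !eqxx mulr1 mul1r.
  rewrite !big1 ?addr0 // => [j ji|j ji].
    by rewrite big1 // => l _; rewrite mxE (negbTE ji) andbF !mul0r.
  by rewrite mxE (negbTE ji) andbF mulr0.
have Dii i : 0 < D i i.
  rewrite E Dpos //; apply/eqP => /matrixP/(_ ord0 i); rewrite !mxE !eqxx /=.
  by move/eqP; rewrite oner_eq0.
rewrite /mxtrace (bigD1 (Ordinal p0)) //= ltr_wpDr //.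
by apply: sumr_ge0 => i _; exact: ltW.
Qed.

(* Otherwise the entry could be added to the family. *)
Lemma max_indep_span (R : realType) (A B : R) q p (C : R -> 'M[R]_(q + p)) m
    (g : 'I_m -> R -> R) : max_indep_nonconstant_entries A B C g ->
  forall i (j : 'I_q), exists (a : R) (b : 'I_m -> R), forall c, c \in `[A, B] ->
    C c i (lshift p j) = a + \sum_(l < m) b l * g l c.
Proof.
move=> [[gC gn gi] gmax] i j; apply: contrapT => nspan.
pose h c := C c i (lshift p j).
pose g' (l : 'I_m.+1) := if unlift ord_max l is Some l' then g l' else h.
have gl l : g' (lift ord_max l) = g l by rewrite /g' liftK.
have gm : g' ord_max = h by rewrite /g' unlift_none.
suff : (m.+1 <= m)%N by rewrite ltnn.
apply: (gmax _ g'); split.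
- move=> l; case: (unliftP ord_max l) => [l' ->|->]; last by rewrite gm; exists i, j.
  by rewrite gl; exact: gC.
- move=> l; case: (unliftP ord_max l) => [l' ->|->]; first by rewrite gl; exact: gn.
  rewrite gm => -[a ha]; apply: nspan; exists a, (fun=> 0) => c cAB.
  by rewrite big1 ?addr0 => [|l' _]; [exact: ha|rewrite mul0r].
- move=> a aP.
  have aE c : c \in `[A, B] -> \sum_(l < m) a (lift ord_max l) * g l c + a ord_max * h c = 0.
    move=> cAB; rewrite -[RHS](aP _ cAB) (bigD1_ord ord_max) //= gm addrC.
    by congr (_ + _); apply: eq_bigr => l _; rewrite gl.
  have am : a ord_max = 0.
    apply/eqP/negPn/negP => am; apply: nspan.
    exists 0, (fun l => - (a (lift ord_max l) / a ord_max)) => c cAB; rewrite add0r.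
    apply: (mulfI am); rewrite mulr_sumr; apply/eqP; rewrite -subr_eq0 -sumrN addrC.
    rewrite -[X in _ == X](aE _ cAB); apply/eqP; congr (_ + _); apply: eq_bigr => l _.
    by rewrite mulNr mulrN opprK mulrA mulrC [a ord_max * _]mulrC divfK // mulrC.
  move=> l; case: (unliftP ord_max l) => [l' ->|->] //.
  apply: (gi (fun l => a (lift ord_max l))) => c cAB.
  by rewrite -[RHS](aE _ cAB) am mul0r addr0.
Qed.

Lemma eq_in_within (R : realType) (D : set R) (f g : R -> R) :
  (forall c, D c -> f c = g c) -> {within D, continuous f} -> {within D, continuous g}.
Proof.
by move=> fg; apply: subspace_eq_continuous => c; rewrite inE; exact: fg.
Qed.

(** * The regression model: continuity of the entries and the improving perturbation *)

Section Model.
Variables (R : realType) (A B : R) (q p1 k : nat) (C : R -> 'M[R]_(q + p1)).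
Variable Psi : nat -> R -> R.
Hypotheses (hAB : A < B) (hp1 : (0 < p1)%N) (hk : (0 < k)%N).
Hypothesis hCsym : forall c, c \in `[A, B] -> (C c)^T = C c.
Hypothesis hPsi : max_indep_nonconstant_entries A B C (fun l : 'I_k.-1 => Psi l.+1).
Hypothesis hdiff : forall i j, differentiable_upto A B k (fun c => C c i j).
Hypotheses (hdefA : f_defined_at A B k Psi C A) (hdefB : f_defined_at A B k Psi C B).
Hypothesis hroots : forall (l : nat) c, (1 <= l <= k.-1)%N -> c \in `[A, B] ->
  f_scal A B Psi l l c != 0.

Lemma oo_cc c : c \in `]A, B[ -> c \in `[A, B].
Proof. by rewrite !in_itv /= => /andP[/ltW -> /ltW ->]. Qed.

Lemma entry_smooth i j : smooth A B k (fun c => C c i j).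
Proof. exact: differentiable_upto_smooth. Qed.

Lemma model_Psi_smooth l : (1 <= l < k)%N -> smooth A B k (Psi l).
Proof.
case: l => // l lk; have [[gC _ _] _] := hPsi.
have lk' : (l < k.-1)%N by rewrite -ltnS prednK.
have [i [j E]] := gC (Ordinal lk').
apply: eq_in_smooth (entry_smooth i (lshift p1 j)) => c /oo_cc cAB.
by rewrite -E.
Qed.

Lemma model_Psi_noroot l : (1 <= l < k)%N -> {in `]A, B[,
  forall c, derive1 (fratio A B Psi (Psi l) l.-1) c != 0}.
Proof.
move=> /andP[l0 lk] c cAB; rewrite -(derive_seg_interior _ cAB).
by apply: hroots; [rewrite l0 -ltnS prednK|exact: oo_cc].
Qed.

Lemma model_Psi_cont l : (1 <= l < k)%N -> {within `[A, B], continuous (Psi l)}.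
Proof.
move=> lk; apply: derivable_seg_within => //.
- move=> c cAB; exact: (smooth_continuous hk (model_Psi_smooth lk)).
- by have [+ _] := hdefA => /(_ 1%N l isT lk).
- by have [+ _] := hdefB => /(_ 1%N l isT lk).
Qed.

Lemma first_columns_cont i (j : 'I_q) :
  {within `[A, B], continuous (fun c => C c i (lshift p1 j))}.
Proof.
have [a [b E]] := max_indep_span hPsi i j.
apply: (@eq_in_within _ _ (fun c => a + \sum_(l < k.-1) b l * Psi l.+1 c)) => [c /= cAB|].
  by rewrite E.
move=> c; apply: cvgD; first exact: cvg_cst.
apply: (@continuous_fun_sum R (subspace `[A, B]) _ _ (fun l c => b l * Psi l.+1 c)) => l y.
apply: cvgM; [exact: cvg_cst|apply: model_Psi_cont].
by have := ltn_ord l; rewrite -ltnS (prednK hk).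
Qed.

(** Derivability at the endpoints is given for the Psi_l and for C22. The first columns inherit
    continuity because they are combinations of 1 and the Psi_l, the upper right block by
    symmetry. *)
Lemma entry_cont i j : {within `[A, B], continuous (fun c => C c i j)}.
Proof.
rewrite -[j](splitK j); case: fintype.split => {}j /=; first exact: first_columns_cont.
rewrite -[i](splitK i); case: fintype.split => {}i /=.
  apply: (@eq_in_within _ _ (fun c => C c (rshift q j) (lshift p1 i))).
    by move=> c /= cAB; rewrite -[in RHS]hCsym // mxE.
  exact: first_columns_cont.
have dC c (Hc : f_defined_at A B k Psi C c) :
    derivable_seg A B (fun c => C c (rshift q i) (rshift q j)) c.
  have [_ /(_ 1%N i j hk)] := Hc; rewrite /= /C22.
  congr (derivable_seg A B _ c); by apply/funext => y; rewrite !mxE.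
apply: derivable_seg_within; [by []| |exact: dC|exact: dC].
by move=> c cAB; exact: (smooth_continuous hk (entry_smooth _ _)).
Qed.

(** The recursion is linear in its starting function, so it commutes with evaluating the quadratic
    form at a fixed [v]. This reduces definiteness of the matrix F to scalar signs. *)
Lemma quad_Fmat z v : z \in `]A, B[ ->
  quad (Fmat A B k Psi C z) v =
  (\prod_(1 <= l < k) derive1 (fratio A B Psi (Psi l) l.-1) z) *
  derive1 (fratio A B Psi (fun c => quad (C22 C c) v) k.-1) z.
Proof.
move=> zAB; rewrite /Fmat quadZ; congr (_ * _).
  apply: eq_bigr => l _; exact: derive_seg_interior.
have km : (k.-1 < k)%N by rewrite prednK.
have S22 i j : smooth A B k (fun c => C22 C c i j).
  apply: eq_in_smooth (entry_smooth (rshift q i) (rshift q j)) => c _.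
  by rewrite !mxE.
pose h i c := \sum_(j < p1) v ord0 j * C22 C c i j.
have Sh i : smooth A B k (h i) by apply: smooth_sum => j; exact: S22.
have Ps := model_Psi_smooth; have Pn := model_Psi_noroot.
have -> : (fun c => quad (C22 C c) v) = (fun c => \sum_i v ord0 i * h i c).
  apply/funext => c; rewrite quadE; apply: eq_bigr => i _.
  by rewrite mulr_sumr; apply: eq_bigr => j _; rewrite -mulrA (mulrC (C22 C c i j)).
rewrite (eq_in_derive1 (fratio_lincomb Ps Pn _ km Sh)) // derive1_lincomb; last first.
  by move=> i; exact: (derivable_fratio Ps Pn km (Sh i)).
rewrite quadE; apply: eq_bigr => i _.
rewrite (eq_in_derive1 (fratio_lincomb Ps Pn _ km (S22 i))) // derive1_lincomb; last first.
  by move=> j; exact: (derivable_fratio Ps Pn km (S22 i j)).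
rewrite mulr_sumr; apply: eq_bigr => j _.
by rewrite !mxE /frec derive_seg_interior // mulrA mulrAC.
Qed.

Section Improvement.
(** [b] encodes the sign hypothesis: [false] for F > 0, [true] for -F > 0. *)
Variable b : bool.
Hypothesis hF : forall c, c \in `[A, B] ->
  forall v, v != 0 -> 0 < (-1) ^+ b * quad (Fmat A B k Psi C c) v.

Lemma improving_weights (x : nat -> R) : A <= x 0 -> x k <= B ->
  (forall i, (i < k)%N -> x i < x i.+1) ->
  exists s : nat -> R, let D := \sum_(i < k.+1) s i *: C (x i) in
  [/\ \sum_(i < k.+1) s i = 0,
      forall i, (i <= k)%N -> s i < 0 -> odd (b + k + i),
      forall v, 0 <= quad D v & 0 < \tr D].
Proof.
move=> Ax xB xlt.
have Ps := model_Psi_smooth; have Pn := model_Psi_noroot; have Pc := model_Psi_cont.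
have [s [sk salt sP]] := exists_alternating Ps Pn hAB Pc hk Ax xB xlt.
have xin i : (i <= k)%N -> x i \in `[A, B].
  move=> ik; rewrite in_itv /=; apply/andP; split.
    by apply: le_trans Ax _; exact: (nodes_le xlt).
  by apply: le_trans xB; exact: (nodes_le xlt).
(* Alternation is counted back from the last node, where the weight is positive. *)
have ssgn d : (d <= k)%N -> 0 < (-1) ^+ d * s (k - d)%N.
  elim: d => [|d IH] dk; first by rewrite subn0 expr0 mul1r.
  have kd : (k - d.+1 < k)%N by rewrite ltn_subrL.
  have := salt _ kd; rewrite -subSn // subSS => ss.
  have := IH (ltnW dk); set y := s (k - d)%N in ss *; set z := s (k - d.+1)%N in ss *.
  rewrite exprS mulN1r mulNr oppr_gt0 => yd.
  rewrite -(pmulr_llt0 _ yd) mulrACA -expr2 sqrr_sign mul1r //.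
have s0 : \sum_(i < k.+1) s i = 0.
  by rewrite -[RHS](sP 0%N hk); apply: eq_bigr => i _; exact/esym/mulr1.
exists (fun i => (-1) ^+ b * s i) => D.
have Dsum (V : lmodType R) (F : R -> V) :
    \sum_(i < k.+1) ((-1) ^+ b * s i) *: F (x i) = (-1) ^+ b *: \sum_(i < k.+1) s i *: F (x i).
  by rewrite scaler_sumr; apply: eq_bigr => i _; rewrite scalerA.
(* The first columns lie in the span of 1 and the Psi_l, which [s] annihilates; by symmetry only the
   lower right block of [D] is left. *)
have D0 a j : D a (lshift p1 j) = 0.
  have [a0 [c E]] := max_indep_span hPsi a j.
  rewrite /D Dsum mxE summxE.
  under eq_bigr => i _ do rewrite mxE (E _ (xin _ (ltn_ord i))) mulrDr.
  rewrite big_split /= -mulr_suml.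
  rewrite s0 mul0r add0r.
  under eq_bigr => i _ do rewrite mulr_sumr.
  rewrite exchange_big big1 ?mulr0 //= => l _.
  under eq_bigr => i _ do rewrite mulrCA.
  rewrite -mulr_sumr (sP l.+1) ?mulr0 //.
  by have := ltn_ord l; rewrite -ltnS (prednK hk).
have Dsym : D^T = D.
  rewrite /D linear_sum; apply: eq_bigr => i _; rewrite linearZ /= hCsym //.
  by apply: xin; rewrite -ltnS.
have D22 v : v != 0 -> 0 < quad (drsubmx D) v.
  move=> v0.
  have -> : quad (drsubmx D) v = (-1) ^+ b * \sum_(i < k.+1) s i * quad (C22 C (x i)) v.
    rewrite /D Dsum -quad_sum -quadZ; congr (quad _ v); apply/matrixP => i j.
    rewrite !mxE !summxE; congr (_ * _); apply: eq_bigr => l _.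
    by rewrite !mxE.
  have Sg : smooth A B k (fun c => quad (C22 C c) v).
    have -> : (fun c => quad (C22 C c) v) =
        (fun c => \sum_i v ord0 i * \sum_j v ord0 j * C c (rshift q i) (rshift q j)).
      apply/funext => c; rewrite quadE; apply: eq_bigr => i _.
      by rewrite mulr_sumr; apply: eq_bigr => j _; rewrite !mxE -mulrA (mulrC (C _ _ _)).
    apply: (@smooth_sum _ _ _ _ _ _ (fun i c => \sum_j v ord0 j * C c (rshift q i) (rshift q j))) => i.
    apply: (@smooth_sum _ _ _ _ _ _ (fun j c => C c (rshift q i) (rshift q j))) => j.
    exact: entry_smooth.
  have gc : {within `[A, B], continuous (fun c => quad (C22 C c) v)}.
    apply: quad_within => i j.
    have -> : (fun c => C22 C c i j) = (fun c => C c (rshift q i) (rshift q j)).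
      by apply/funext => c; rewrite !mxE.
    exact: entry_cont.
  have [z zAB E] := sgr_alternating_sum Ps Pn hAB Pc hk Ax xB xlt Sg gc sP.
  rewrite -sgr_gt0 sgrM E (gtr0_sg sk) mul1r -quad_Fmat // -sgrM sgr_gt0.
  by apply: hF => //; exact: oo_cc.
split.
- by rewrite -mulr_sumr s0 mulr0.
- move=> i ik si; have := ssgn (k - i)%N (leq_subr _ _); rewrite subKn // => si'.
  have : (-1) ^+ b * (-1) ^+ (k - i) < (0 : R).
    by rewrite -(pmulr_llt0 _ si') -mulrA signrMK.
  rewrite -exprD -signr_odd signr_lt0.
  by rewrite -addnA !oddD oddB.
- move=> v; rewrite quad_block0 //.
  by have [->|v0] := eqVneq (rsubmx v) 0; [rewrite /quad !mul0mx mxE|exact/ltW/D22].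
- rewrite -[D]submxK mxtrace_block.
  have -> : ulsubmx D = 0 by apply/matrixP => i j; rewrite !mxE D0.
  by rewrite mxtrace0 add0r; exact: trace_posdef D22.
Qed.

(** Negative weights sit at those i with b + k + i odd. The shift [o] makes i + o even there, so
    these nodes are points of [T], not midpoints. The nodes used have indices from o to k + o,
    whence the bounds on [size T] and on 2i. *)
Lemma improve (S T : seq R) (W : R -> R) (o := odd (b + k).+1) :
  uniq S -> (forall x, x \in S -> x \in `[A, B] /\ 0 < W x) ->
  \sum_(x <- S) W x = 1 ->
  sorted <%R T -> (forall x, x \in T -> x \in `[A, B]) ->
  ((k + o).+1./2 < size T)%N ->
  (forall i, (o <= i.*2 <= k + o)%N -> nth 0 T i \in S) ->
  exists M', [/\ attainable A B C M',
    forall v, 0 <= quad (M' - \sum_(x <- S) W x *: C x) v &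
    \tr (\sum_(x <- S) W x *: C x) < \tr M'].
Proof.
move=> uS SP W1 Ts TAB kT TS.
pose x i := node T (i + o).
have xin i : (i <= k)%N -> x i \in `[A, B].
  move=> ik; apply: node_in => //; apply: leq_ltn_trans kT.
  by apply: half_leq; rewrite ltnS leq_add2r.
have xlt i : (i < k)%N -> x i < x i.+1.
  move=> ik; apply: node_lt => //; apply: leq_ltn_trans kT.
  by apply: (@half_leq (i + o).+2); rewrite ltnS ltn_add2r.
have Ax : A <= x 0 by have := xin 0%N isT; rewrite in_itv /= => /andP[].
have xB : x k <= B by have := xin k (leqnn k); rewrite in_itv /= => /andP[].
have [s /= [s0 sneg sge str]] := improving_weights Ax xB xlt.
set M := \sum_(x <- S) _.
have [e e0 Matt] : exists2 e, 0 < e & attainable A B C (M + e *: \sum_(i < k.+1) s i *: C (x i)).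
  apply: attainable_perturb => // i ik si.
  have io : ~~ odd (i + o).
    have := sneg i ik si; rewrite /o !oddD /= oddD; by case: (b) (odd k) (odd i) => [] [] [].
  rewrite /x node_even //; apply: TS; rewrite halfK (negbTE io) subn0.
  by rewrite leq_addl leq_add2r.
exists (M + e *: \sum_(i < k.+1) s i *: C (x i)); split=> //.
- by move=> v; rewrite addrC addKr quadZ mulr_ge0 // ltW.
- by rewrite linearD /= ltrDl linearZ /= mulr_gt0.
Qed.

(** Points of [E] may carry no weight and so must not lose any: the condition on [T] keeps them off
    the nodes that can be negative, which therefore all lie in the support. A support that is too
    large would then contradict the maximality of the trace. *)
Lemma dominating_support (E : seq R) N M0 (o := odd (b + k).+1) :
  attainable A B C M0 ->
  (forall x, x \in E -> x \in `[A, B]) ->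
  ((k + o).+1./2 <= N)%N ->
  (forall T, sorted <%R T -> (forall x, x \in T -> x \in `[A, B]) ->
    (N < size T)%N -> forall i, (o <= i.*2 <= k + o)%N -> nth 0 T i \notin E) ->
  exists (S : seq R) (W : R -> R), [/\ uniq S,
    forall x, x \in S -> x \in `[A, B] /\ 0 < W x, \sum_(x <- S) W x = 1,
    (size (undup (E ++ S)) <= N)%N &
    forall v, 0 <= quad (\sum_(x <- S) W x *: C x - M0) v].
Proof.
move=> M0att EAB kN TE.
have [M1 [M1att M1ge M1max]] := exists_max_trace (ltW hAB) entry_cont M0att.
have [S [W [uS SP W1 WM]]] := attainable_support M1att.
exists S, W; split=> //; last by rewrite WM.
rewrite leqNgt; apply/negP => NT.
pose T := sort <=%R (undup (E ++ S)).
have Tmem x : (x \in T) = (x \in E) || (x \in S) by rewrite mem_sort mem_undup mem_cat.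
have Ts : sorted <%R T.
  by rewrite lt_sorted_uniq_le sort_uniq undup_uniq sort_le_sorted.
have TAB x : x \in T -> x \in `[A, B].
  by rewrite Tmem => /orP[/EAB //|/SP[]].
have sT : (N < size T)%N by rewrite size_sort.
have oN : ((k + o).+1./2 < size T)%N by apply: leq_ltn_trans sT.
have [] := @improve S T W uS SP W1 Ts TAB oN.
  move=> i io; have iT : (i < size T)%N.
    apply: leq_ltn_trans oN; move: io => /andP[_ io].
    by rewrite -[i]doubleK; apply: half_leq; exact: leqW.
  have := mem_nth 0 iT; rewrite Tmem => /orP[iE|//].
  by move: (TE T Ts TAB sT i io); rewrite iE.
move=> M' [M'att M'ge]; rewrite WM in M'ge *; rewrite ltNge => /negP; apply.
apply: M1max => // v; have -> : M' - M0 = (M' - M1) + (M1 - M0) by rewrite addrA subrK.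
by rewrite quadD addr_ge0.
Qed.

End Improvement.
End Model.

(** This is the common form of the four cases, which differ in the sign [b], the prescribed points
    [E] and the bound [N]. *)
Lemma complete_class_at_most (R : realType) (A B : R) (q p1 k : nat)
  (P : 'M[R]_(q + p1)) (C : R -> 'M[R]_(q + p1))
  (Info : design A B -> 'M[R]_(q + p1)) (Psi : nat -> R -> R)
  (b : bool) (E : seq R) (N : nat) (o := odd (b + k).+1) :
  A < B -> (0 < p1)%N -> (0 < k)%N ->
  (forall c, c \in `[A, B] -> (C c)^T = C c) ->
  (forall xi : design A B,
     Info xi = P *m (\sum_(i < npts xi) wt xi i *: C (pt xi i)) *m P^T) ->
  max_indep_nonconstant_entries A B C (fun l : 'I_k.-1 => Psi l.+1) ->
  (forall i j, differentiable_upto A B k (fun c => C c i j)) ->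
  f_defined_at A B k Psi C A -> f_defined_at A B k Psi C B ->
  (forall (l : nat) (c : R), (1 <= l <= k.-1)%N -> c \in `[A, B] ->
     f_scal A B Psi l l c != 0) ->
  (forall c, c \in `[A, B] -> posdef ((-1) ^+ b *: Fmat A B k Psi C c)) ->
  (forall x, x \in E -> x \in `[A, B]) ->
  ((k + o).+1./2 <= N)%N ->
  (forall T, sorted <%R T -> (forall x, x \in T -> x \in `[A, B]) ->
    (N < size T)%N -> forall i, (o <= i.*2 <= k + o)%N -> nth 0 T i \notin E) ->
  complete_class Info (at_most_including N E).
Proof.
move=> hAB hp1 hk hCsym hInfo hPsi hdiff hdefA hdefB hroots hF EAB kN TE xi.
pose M0 := \sum_(i < npts xi) wt xi i *: C (pt xi i).
have att : attainable A B C M0.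
  exists (npts xi), (pt xi), (wt xi); split=> //.
  - exact: pt_in.
  - by move=> i; exact/ltW/wt_gt0.
  - exact: wt_sum1.
have hF' c : c \in `[A, B] -> forall v, v != 0 -> 0 < (-1) ^+ b * quad (Fmat A B k Psi C c) v.
  by move=> cAB v v0; rewrite -quadZ; have [_] := hF c cAB; exact.
have [S [W [uS SP W1 sz ge]]] := dominating_support hAB hp1 hk hCsym hPsi hdiff
  hdefA hdefB hroots hF' att EAB kN TE.
have [xi' [ptE sumE]] := design_of_support uS SP W1.
exists xi'; split; first by rewrite /at_most_including ptE.
have Msym (nu : design A B) : (Info nu)^T = Info nu.
  rewrite hInfo !trmx_mul trmxK linear_sum mulmxA; congr (_ *m _ *m _).
  by apply: eq_bigr => i _; rewrite linearZ /= hCsym // pt_in.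
split; first by rewrite linearB /= !Msym.
move=> v; rewrite !hInfo sumE -mulmxBl -mulmxBr.
(* Congruence by [P] turns the form at [v] into the form at [v *m P], so domination carries over. *)
have -> : v *m (P *m (\sum_(x <- S) W x *: C x - M0) *m P^T) *m v^T =
    (v *m P) *m (\sum_(x <- S) W x *: C x - M0) *m (v *m P)^T.
  by rewrite trmx_mul !mulmxA.
exact: ge.
Qed.

Theorem theorem2 (R : realType) (A B : R) (q p1 k : nat)
  (P : 'M[R]_(q + p1)) (C : R -> 'M[R]_(q + p1))
  (Info : design A B -> 'M[R]_(q + p1))
  (Psi : nat -> R -> R)
  (hAB : A < B) (hq : (0 < q)%N) (hp1 : (0 < p1)%N) (hk : (0 < k)%N)
  (hP : P \in unitmx)
  (hCsym : forall c : R, c \in `[A, B] -> (C c)^T = C c)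
  (hInfo : forall xi : design A B,
     Info xi = P *m (\sum_(i < npts xi) wt xi i *: C (pt xi i)) *m P^T)
  (hPsi : max_indep_nonconstant_entries A B C
            (fun l : 'I_k.-1 => Psi l.+1))
  (hdiff : forall i j, differentiable_upto A B k (fun c => C c i j))
  (hdefA : f_defined_at A B k Psi C A)
  (hdefB : f_defined_at A B k Psi C B)
  (hroots : forall (l : nat) (c : R), (1 <= l <= k.-1)%N -> c \in `[A, B] ->
     f_scal A B Psi l l c != 0)
  (hF : (forall c : R, c \in `[A, B] -> posdef (Fmat A B k Psi C c)) \/
        (forall c : R, c \in `[A, B] -> posdef (- Fmat A B k Psi C c))) :
  [/\ forall n, k = (2 * n - 1)%N ->
        (forall c : R, c \in `[A, B] -> posdef (Fmat A B k Psi C c)) ->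
        complete_class Info (at_most_including n [:: B]),
      forall n, k = (2 * n - 1)%N ->
        (forall c : R, c \in `[A, B] -> posdef (- Fmat A B k Psi C c)) ->
        complete_class Info (at_most_including n [:: A]),
      forall n, k = (2 * n)%N ->
        (forall c : R, c \in `[A, B] -> posdef (Fmat A B k Psi C c)) ->
        complete_class Info (at_most_including n.+1 [:: A; B])
    & forall n, k = (2 * n)%N ->
        (forall c : R, c \in `[A, B] -> posdef (- Fmat A B k Psi C c)) ->
        complete_class Info (at_most_including n [::])].
Proof.
have A_in : A \in `[A, B] by rewrite in_itv /= lexx ltW.
have B_in : B \in `[A, B] by rewrite in_itv /= lexx ltW.
(* In a strictly increasing list in [A, B] only the last entry can be B, and only the first can be
   A. *)
have neqB T i : sorted <%R T -> (forall x, x \in T -> x \in `[A, B]) ->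
    (i.+1 < size T)%N -> nth 0 T i != B.
  move=> Ts TAB iT; rewrite lt_eqF //; apply: lt_le_trans (nth_sorted_lt Ts (ltnSn i) iT) _.
  by have := TAB _ (mem_nth 0 iT); rewrite in_itv /= => /andP[].
have neqA T i : sorted <%R T -> (forall x, x \in T -> x \in `[A, B]) ->
    (0 < i < size T)%N -> nth 0 T i != A.
  move=> Ts TAB /andP[i0 iT]; rewrite gt_eqF //; apply: le_lt_trans (nth_sorted_lt Ts i0 iT).
  by have := TAB _ (mem_nth 0 (ltn_trans i0 iT)); rewrite in_itv /= => /andP[].
pose cc (b : bool) E N := @complete_class_at_most R A B q p1 k P C Info Psi b E N
  hAB hp1 hk hCsym hInfo hPsi hdiff hdefA hdefB hroots.
have parity (b : bool) n : odd (b + (2 * n)).+1 = ~~ b by rewrite mul2n /= oddD odd_double addbF oddb.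
have parity' (b : bool) n : (0 < n)%N -> odd (b + (2 * n - 1)).+1 = b.
  move=> n0; have -> : ((b + (2 * n - 1)).+1 = b + n.*2)%N by lia.
  by rewrite oddD odd_double addbF oddb.
split=> n kn hFn.
(* Here o = 0: mass is lost only among t_0, ..., t_(n-1), which excludes the last of more than n
   points. n = 0 would give k = 0 by truncated subtraction. *)
- have n0 : (0 < n)%N by lia.
  have hFb c : c \in `[A, B] -> posdef ((-1) ^+ false *: Fmat A B k Psi C c).
    by move=> cAB; rewrite scale1r; exact: hFn.
  apply: (cc false _ _ hFb) => [x||T Ts TAB NT i]; rewrite ?kn ?parity' //.
  + by rewrite inE => /eqP ->.
  + by rewrite /= ?addn0; lia.
  + by move=> /= io; rewrite inE neqB //; lia.
(* Here o = 1: mass is lost only among t_1, ..., t_n, which excludes the first point. *)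
- have n0 : (0 < n)%N by lia.
  have hFb c : c \in `[A, B] -> posdef ((-1) ^+ true *: Fmat A B k Psi C c).
    by move=> cAB; rewrite scaleN1r; exact: hFn.
  apply: (cc true _ _ hFb) => [x||T Ts TAB NT i]; rewrite ?kn ?parity' //.
  + by rewrite inE => /eqP ->.
  + by rewrite /=; lia.
  + by move=> /= io; rewrite inE neqA //; lia.
(* Here o = 1: mass is lost only among t_1, ..., t_n, and with more than n+1 points neither the
   first nor the last is among them. *)
- have hFb c : c \in `[A, B] -> posdef ((-1) ^+ false *: Fmat A B k Psi C c).
    by move=> cAB; rewrite scale1r; exact: hFn.
  apply: (cc false _ _ hFb) => [x||T Ts TAB NT i]; rewrite ?kn ?parity //.
  + by rewrite !inE => /orP[] /eqP ->.
  + by rewrite /=; lia.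
  + by move=> /= io; rewrite !inE negb_or neqA ?neqB //; lia.
(* Here o = 0 and the points t_0, ..., t_n can all lose mass, so no endpoint is prescribed. *)
- have hFb c : c \in `[A, B] -> posdef ((-1) ^+ true *: Fmat A B k Psi C c).
    by move=> cAB; rewrite scaleN1r; exact: hFn.
  apply: (cc true _ _ hFb) => [x||T Ts TAB NT i]; rewrite ?kn ?parity //.
  by rewrite /=; lia.
Qed.
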